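(* Let $Z_i=(X_i,Y_i)$, $i=1,\dots,n+1$, be i.i.d. from a distribution $\mathcal P_{XY}$, let $V(\cdot)$ be a fixed real-valued score function, $V_i=V(Z_i)$, and let $P_{V|x}(v)=\mathbb P(V(Z)\le v\mid X=x)$. Use the localizer $H(x_1,x_2)=\exp(-d(x_1,x_2)/h_n)$, where $h_n>0$ is a bandwidth and $d(x_1,x_2)\ge0$ with $d(x,x)=0$. Assume: $X$ has a continuous distribution on $[0,1]^p$ and $V(Z)$ has a continuous distribution conditional on $X=x$; there exist constants $L>0$, $\beta\ge0$ such that the density of $X$ satisfies $p_X(x)\ge1/L$ on $[0,1]^p$ and (i) $\max_{v\in\mathbb R}|P_{V|x}(v)-P_{V|x'}(v)|\le L\,d(x,x')$ for all $x,x'\in[0,1]^p$; (ii) $\mathbb P(d(x_0,X)\le\varepsilon)\ge\varepsilon^\beta/L$ for all $\varepsilon\le h_n$ and all $x_0\in[0,1]^p$; (iii) $h_n\to0$ and $nh_n^\beta/\ln n\to\infty$ as $n\to\infty$. Put $H_{ij}=H(X_i,X_j)$, $p^H_{ij}=H_{ij}/\sum_{k=1}^{n+1}H_{ik}$, $\Gamma=\{\sum_{k\in I}p^H_{ik}: i\in\{1,\dots,n+1\},\ I\subseteq\{1,\dots,n+1\}\}$, $\hat{\mathcal F}_i(v)=\sum_{j=1}^{n}p^H_{ij}\delta_{V_j}+p^H_{i,n+1}\delta_v$ and $\hat{\mathcal F}=\sum_{j=1}^np^H_{n+1,j}\delta_{V_j}+p^H_{n+1,n+1}\delta_{+\infty}$.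 Fix $\alpha\in(0,1)$; for each $v$ let $\tilde\alpha(v)$ be the smallest $\tilde\alpha\in\Gamma$ with $\frac{1}{n+1}\sum_{i=1}^{n+1}\mathbb 1\{V_i\le Q(\tilde\alpha;\hat{\mathcal F}_i(v))\}\ge\alpha$ (with $V_{n+1}=v$ in this sum), and $C_V(X_{n+1})=\{v: v\le Q(\tilde\alpha(v);\hat{\mathcal F})\}$. Then for any $x_0\in[0,1]^p$: $$\lim_{n\to\infty}\mathbb P(V_{n+1}\in C_V(X_{n+1})\mid X_{n+1}=x_0)=\alpha,$$ $$\lim_{n\to\infty}\mathbb P(V_{n+1}\le Q(\alpha;\hat{\mathcal F})\mid X_{n+1}=x_0)=\alpha,$$ $$\lim_{n\to\infty}\mathbb P\big(\max_v|\tilde\alpha(v)-\alpha|<\varepsilon\mid X_{n+1}=x_0\big)=1\quad\text{for all }\varepsilon>0.$$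
   Context: For a distribution $\mathcal F$ on $\mathbb R\cup\{+\infty\}$, $Q(\alpha;\mathcal F)=\inf\{t:\mathbb P_{T\sim\mathcal F}(T\le t)\ge\alpha\}$; $\delta_v$ is the point mass at $v$. *)

(* Defs.v *)
From HB Require Import structures.
From mathcomp Require Import all_boot all_order all_algebra.
From mathcomp Require Import all_classical all_reals all_analysis.
Set Implicit Arguments. Unset Strict Implicit. Unset Printing Implicit Defensive.
Import Order.TTheory GRing.Theory Num.Theory.
Import numFieldNormedType.Exports.
Local Open Scope classical_set_scope.
Local Open Scope ring_scope.

Section LocalizedConformal.
Variable R : realType.

(* A discrete distribution sum_j w j * delta_(a j) with atoms a j : \bar R. *)
Definition dcdf (m : nat) (w : 'I_m -> R) (a : 'I_m -> \bar R) (t : R) : R :=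
  \sum_(j < m) w j * ((a j <= t%:E)%E)%:R.

(* Q(alpha; F) = inf { t : P_{T ~ F}(T <= t) >= alpha } (in \bar R; inf set0 = +oo) *)
Definition dquantile (m : nat) (alpha : R) (w : 'I_m -> R) (a : 'I_m -> \bar R)
  : \bar R := ereal_inf (EFin @` [set t : R | alpha <= dcdf w a t]).

Variable T : Type.

Definition localizer (d : T -> T -> R) (h : R) (x1 x2 : T) : R :=
  expR (- (d x1 x2 / h)).

(* n+1 points indexed by 'I_n.+1; index ord_max is the test point n+1. *)
Definition pH (n : nat) d h (X : 'I_n.+1 -> T) (i j : 'I_n.+1) : R :=
  localizer d h (X i) (X j) / \sum_(k < n.+1) localizer d h (X i) (X k).

Definition Gamma n d h (X : 'I_n.+1 -> T) : set R :=
  [set a | exists (i : 'I_n.+1) (I : {set 'I_n.+1}), a = \sum_(k in I) pH d h X i k].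

Definition atoms_i n (V : 'I_n.+1 -> R) (v : R) (j : 'I_n.+1) : \bar R :=
  if j == ord_max then v%:E else (V j)%:E.

Definition atoms_hat n (V : 'I_n.+1 -> R) (j : 'I_n.+1) : \bar R :=
  if j == ord_max then +oo%E else (V j)%:E.

Definition Vrep n (V : 'I_n.+1 -> R) (v : R) (i : 'I_n.+1) : R :=
  if i == ord_max then v else V i.

Definition score_frac n d h (X : 'I_n.+1 -> T) (V : 'I_n.+1 -> R) (aa v : R) : R :=
  (n.+1%:R)^-1 * \sum_(i < n.+1)
     (((Vrep V v i)%:E <= dquantile aa (pH d h X i) (atoms_i V v))%E)%:R.

Definition alpha_tilde n d h (X : 'I_n.+1 -> T) (V : 'I_n.+1 -> R) (alpha v : R) : R :=
  inf [set aa | Gamma d h X aa /\ alpha <= score_frac d h X V aa v].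

Definition Fhat_quantile n d h (X : 'I_n.+1 -> T) (V : 'I_n.+1 -> R) (aa : R) : \bar R :=
  dquantile aa (pH d h X ord_max) (atoms_hat V).

Definition conf_set n d h (X : 'I_n.+1 -> T) (V : 'I_n.+1 -> R) (alpha : R) : set R :=
  [set v | (v%:E <= Fhat_quantile d h X V (alpha_tilde d h X V alpha v))%E].

End LocalizedConformal.

(* Calibration points Z_1..Z_n are Zs 0 .. Zs (n-1); test point (x0, y0). *)
Definition sampleX {Tx Ty Om : Type} (n : nat) (Zs : nat -> Om -> Tx * Ty)
  (x0 : Tx) (om : Om) (i : 'I_n.+1) : Tx :=
  if (i < n)%N then (Zs i om).1 else x0.

Definition sampleV {Tx Ty Om : Type} {R : realType} (V : Tx * Ty -> R) (n : nat)
  (Zs : nat -> Om -> Tx * Ty) (x0 : Tx) (W : Om -> Ty) (om : Om) (i : 'I_n.+1) : R :=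
  if (i < n)%N then V (Zs i om) else V (x0, W om).

Definition unit_cube (R : realType) (p : nat) : set (p.-tuple R) :=
  [set x | forall i : 'I_p, 0 <= tnth x i <= 1].

Definition box (R : realType) (p : nat) (a b : p.-tuple R) : set (p.-tuple R) :=
  [set x | forall i : 'I_p, tnth a i <= tnth x i <= tnth b i].
Arguments unit_cube R p _ : clear implicits.
Arguments sampleX {Tx Ty Om} n Zs x0 om i.
Arguments sampleV {Tx Ty Om R} V n Zs x0 W om i.

(* Main.v *)
Require Import Defs.
From HB Require Import structures.
From mathcomp Require Import all_boot all_order all_algebra.
From mathcomp Require Import all_classical all_reals all_analysis.
From mathcomp Require Import measurable_realfun.
From mathcomp Require Import ring lra.
Import Order.TTheory GRing.Theory Num.Theory.
Import numFieldNormedType.Exports.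
Local Open Scope classical_set_scope.
Local Open Scope ring_scope.
Set Implicit Arguments.
Unset Strict Implicit.
Unset Printing Implicit Defensive.

(** The quantile condition [v <= Q(a; F)] says that the mass of [F] strictly below [v] is less
    than [a], so everything reduces to the localized ranks
    [G_i = sum_j p_ij 1{V_j < V_i}] (see [local_rank]).  Each [G_i] is uniformly close to
    [U_i = P_{V|X_i}(V_i)]: conditionally on [Z_i] the sum
    [sum_j H_ij (+-(1{V_j < V_i} - U_i) - eps)] has independent terms whose exponential
    moments are at most [1 - c h_n^beta] (the Lipschitz condition controls close points, the
    exponential localizer the distant ones), so a Chernoff bound and a union bound over the
    [n + 1] rows suffice because [n h_n^beta / ln n] tends to infinity.  The same bound also
    forces every weight [p_ij] to be small, so [Gamma] is [eps]-dense in [0, 1].  The [U_i] are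
    uniform by the probability integral transform, and the law of large numbers then pins
    [alpha_tilde v] to [alpha] uniformly in [v]: changing [v] alters one row and one weight
    per row.  Finally [U_{n+1}] is uniform given [X_{n+1} = x0], which gives both coverage
    limits. *)

(** The terms of row [i] are independent only once [Z_i] is fixed, and all rows share one sample.
    Instead of conditional laws, the proof freezes [Z_i] by a Fubini argument over the sigma-algebra
    of all data but one [Z_k], and integrates the [Z_k] out one at a time. Putting [- eps] inside
    the weighted sum clears the random normalization of the weights: a negative sum for both signs
    [(-1) ^+ b] says exactly that the rank is within [eps] of its target, and adding the two signs
    cancels the ranks and leaves a lower bound on the total weight. Row sums omit the test index, so
    the candidate [v] does not enter them and one bad event serves all [v]. *)

(** * Joint law of a covariate and a response drawn from a kernel *)

Section KernelGraph.
Context (dX dY : measure_display) (X : measurableType dX) (Y : measurableType dY).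
Context (R : realType) (K : R.-pker X ~> Y).

(* The dummy [unit] component is the parameter that [kcomp] threads through. *)
Definition kgraph (u : unit * X) : {measure set (X * Y) -> \bar R} :=
  measure_function_pushforward__canonical__measure_function_Measure
    (K u.2) (measurable_pair1 u.2).

Let measurable_kgraph (A : set (X * Y)) : measurable A ->
  measurable_fun [set: unit * X] (kgraph ^~ A).
Proof.
move=> mA; have -> : kgraph ^~ A = (fun x => K x (xsection A x)) \o snd.
  by apply/funext => -[u x]; rewrite /= /kgraph/= /pushforward xsectionE.
apply: measurableT_comp => //.
by apply: measurable_fun_xsection_finite_kernel; rewrite inE.
Qed.

HB.instance Definition _ := isKernel.Build _ _ _ _ R kgraph measurable_kgraph.

Let kgraph_setT u : kgraph u setT = 1%E.
Proof. by rewrite /kgraph/= /pushforward preimage_setT prob_kernel. Qed.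

HB.instance Definition _ :=
  Kernel_isProbability.Build _ _ _ _ R kgraph kgraph_setT.

End KernelGraph.

Section JointLaw.
Context (dX dY : measure_display) (X : measurableType dX) (Y : measurableType dY).
Context (R : realType) (PX : probability X R) (K : R.-pker X ~> Y).
Context (dO : measure_display) (Om : measurableType dO) (P : probability Om R).
Variable Z : Om -> X * Y.
Hypothesis mZ : measurable_fun setT Z.
Hypothesis Zlaw : forall (A : set X) (B : set Y), measurable A -> measurable B ->
  P (Z @^-1` (A `*` B)) = (\int[PX]_(x in A) K x B)%E.

(** The law of [Z] and the composition of [PX] with the graph kernel agree on rectangles, a
    generating pi-system, hence as measures. Integrals under [P] thus become iterated integrals. *)
Lemma integral_joint_law (f : X * Y -> \bar R) : measurable_fun setT f ->
  (forall z, 0 <= f z)%E ->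
  (\int[P]_om f (Z om) = \int[PX]_x \int[K x]_y f (x, y))%E.
Proof.
move=> mf f0.
pose Z' : {mfun Om >-> (X * Y)%type} := HB.pack Z (isMeasurableFun.Build _ _ _ _ _ mZ).
have mcst : measurable_fun [set: unit] (fun=> PX : pprobability X R) by exact: measurable_cst.
pose l := kprobability mcst.
have -> : (\int[P]_om f (Z om) = \int[distribution P Z']_z f z)%E.
  by rewrite ge0_integral_distribution.
transitivity (\int[kcomp l (kgraph K) tt]_z f z)%E; last first.
  rewrite integral_kcomp//; apply: eq_integral => x _ /=.
  by rewrite ge0_integral_pushforward.
apply: eq_measure_integral => A mA _.
apply: (measure_unique [set A `*` B | A in measurable & B in measurable] (fun=> setT)) => //.
- exact: measurable_prod_measurableType.
- move=> _ _ [X1 mX1 [X2 mX2 <-]] [Y1 mY1 [Y2 mY2 <-]].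
  exists (X1 `&` Y1); first exact: measurableI.
  by exists (X2 `&` Y2); [exact: measurableI|rewrite setXI].
- by move=> _; exists setT => //; exists setT => //; rewrite setXTT.
- by rewrite bigcup_const//; exists 0%N.
- move=> _ [A1 mA1 [A2 mA2 <-]].
  rewrite -[LHS]/(P (Z @^-1` (A1 `*` A2))) Zlaw// /= /kcomp [LHS]integral_mkcond.
  apply: eq_integral => x _; rewrite /= /pushforward patchE.
  case: ifPn => xA.
    by congr (K x _); apply/seteqP; split => y /=; rewrite inE in xA; tauto.
  rewrite (_ : _ @^-1` _ = set0) ?measure0//.
  by apply/seteqP; split => y //= -[]; rewrite notin_setE in xA.
- by move=> _; rewrite ltey_eq fin_num_measure.
Qed.

End JointLaw.

(** * Fubini for a variable independent of a sub-sigma-algebra *)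

Section IndependentFubini.
Context (dO : measure_display) (Om : measurableType dO) (R : realType).
Context (P : probability Om R) (dT : measure_display) (T : measurableType dT).
Variables (G : set (set Om)) (Z : Om -> T).
Hypothesis mZ : measurable_fun setT Z.
Hypothesis mG : G `<=` measurable.
Hypothesis GT : G setT.
Hypothesis GI : setI_closed G.
Hypothesis indepG : forall A B, G A -> measurable B ->
  P (A `&` Z @^-1` B) = (P A * P (Z @^-1` B))%E.

(** For fixed [B] both sides are finite measures in [A], a restriction and a multiple of [P], which
    agree on the pi-system [G]. *)
Lemma indep_sigma A B : <<s G >> A -> measurable B ->
  P (A `&` Z @^-1` B) = (P A * P (Z @^-1` B))%E.
Proof.
move=> GA mB; have mZB : measurable (Z @^-1` B).
  by rewrite -[X in measurable X]setTI; exact: mZ.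
have r0 : 0 <= fine (P (Z @^-1` B)) by rewrite fine_ge0.
pose m1 := mrestr P mZB; pose m2 := mscale (NngNum r0) P.
rewrite -[LHS]/(m1 A); transitivity (m2 A); last first.
  by rewrite /m2 /mscale/= fineK ?fin_num_measure// muleC.
apply: (g_sigma_algebra_measure_unique G mG (fun=> setT)) => //.
- by rewrite bigcup_const//; exists 0%N.
- move=> A' GA'; rewrite -[LHS]/(P (A' `&` Z @^-1` B)) indepG//.
  by rewrite -[RHS]/((fine (P (Z @^-1` B)))%:E * P A')%E fineK ?fin_num_measure// muleC.
- by move=> _; rewrite -[ltLHS]/(P (setT `&` Z @^-1` B)) setTI ltey_eq fin_num_measure.
Qed.

Lemma measurable_integral_independent (f : g_sigma_algebraType G * T -> \bar R) :
  measurable_fun setT f -> (forall z, 0 <= f z)%E ->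
  measurable_fun [set: Om] (fun om => \int[P]_om' f (om, Z om'))%E.
Proof.
move=> mf f0.
have sGm : <<s G >> `<=` measurable.
  by apply: smallest_sub => //; exact: sigma_algebra_measurable.
pose Z' : {mfun Om >-> T} := HB.pack Z (isMeasurableFun.Build _ _ _ _ _ mZ).
move=> _ A mA; rewrite setTI; apply: sGm.
have := @measurable_fun_fubini_tonelli_F _ _ _ _ _ (distribution P Z') _ mf f0.
move=> /(_ measurableT _ mA); rewrite setTI.
suff -> : fubini_F (distribution P Z') f =
    (fun om => \int[P]_om' f (om, Z om'))%E by [].
apply/funext => om; rewrite /fubini_F ge0_integral_distribution//.
exact: measurable_fun_pair2.
Qed.

(** The freezing lemma: under independence, [om |-> (om, Z om)] has a product law as soon as its
    first component is only observed through the sigma-algebra generated by [G]. *)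
Lemma integral_independent (f : g_sigma_algebraType G * T -> \bar R) :
  measurable_fun setT f -> (forall z, 0 <= f z)%E ->
  (\int[P]_om f (om, Z om) = \int[P]_om \int[P]_om' f (om, Z om'))%E.
Proof.
move=> mf f0.
have sGm : <<s G >> `<=` measurable.
  by apply: smallest_sub => //; exact: sigma_algebra_measurable.
have mid : measurable_fun setT (id : Om -> g_sigma_algebraType G).
  by move=> _ A GA; rewrite setTI preimage_id; exact: sGm.
pose I : {mfun Om >-> g_sigma_algebraType G} :=
  HB.pack (id : Om -> g_sigma_algebraType G) (isMeasurableFun.Build _ _ _ _ _ mid).
pose Z' : {mfun Om >-> T} := HB.pack Z (isMeasurableFun.Build _ _ _ _ _ mZ).
pose J om : g_sigma_algebraType G * T := (om, Z om).
have mJ : measurable_fun setT J by exact: measurable_fun_pair.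
pose J' : {mfun Om >-> (g_sigma_algebraType G * T)%type} :=
  HB.pack J (isMeasurableFun.Build _ _ _ _ _ mJ).
transitivity (\int[distribution P J']_z f z)%E.
  by rewrite ge0_integral_distribution.
transitivity (\int[(distribution P I \x distribution P Z')%E]_z f z)%E.
  apply: eq_measure_integral => A mA _; apply/esym.
  apply: product_measure_unique => // A1 A2 mA1 mA2.
  exact: indep_sigma.
rewrite fubini_tonelli1//.
rewrite ge0_integral_distribution//.
- apply: eq_integral => om _ /=; rewrite /fubini_F ge0_integral_distribution//.
  exact: measurable_fun_pair2.
- exact: measurable_fun_fubini_tonelli_F.
- by move=> om; exact: integral_ge0.
Qed.

End IndependentFubini.

(** * Integrating out independent observations and a Chernoff bound *)

Section IndependentFamily.
Context (dO dT dY : measure_display) (Om : measurableType dO) (R : realType).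
Context (P : probability Om R) (T : measurableType dT) (Y : measurableType dY).
Variables (Zs : nat -> Om -> T) (W : Om -> Y).
Hypothesis mZs : forall i, measurable_fun setT (Zs i).
Hypothesis mW : measurable_fun setT W.
Hypothesis indepZW : forall (s : seq nat) (A : nat -> set T) (B : set Y),
  uniq s -> (forall i, measurable (A i)) -> measurable B ->
  fine (P (W @^-1` B `&` \big[setI/setT]_(i <- s) (Zs i @^-1` A i)))
    = fine (P (W @^-1` B)) * \prod_(i <- s) fine (P (Zs i @^-1` A i)).

(** A pi-system generating the information in all data except [Zs k]. Slot [k] is left free, and the
    threshold [N] keeps each cylinder finite-dimensional, within reach of the independence
    hypothesis on finite families. *)
Definition cylinders_without (k : nat) : set (set Om) :=
  [set E | exists (A : nat -> set T) (B : set Y),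
     [/\ (forall i, measurable (A i)), measurable B, A k = setT,
         (exists N, forall i, (N <= i)%N -> A i = setT) &
         E = W @^-1` B `&` \bigcap_i (Zs i @^-1` A i)]].

Let mpreZ i A : measurable A -> measurable (Zs i @^-1` A).
Proof. by move=> mA; rewrite -[X in measurable X]setTI; exact: mZs. Qed.

Let mpreW A : measurable A -> measurable (W @^-1` A).
Proof. by move=> mA; rewrite -[X in measurable X]setTI; exact: mW. Qed.

Lemma measurable_cylinders_without k : cylinders_without k `<=` measurable.
Proof.
move=> _ [A [B [mA mB _ _ ->]]]; apply: measurableI; first exact: mpreW.
by apply: bigcapT_measurable => i; exact: mpreZ.
Qed.

Lemma cylinders_withoutT k : cylinders_without k setT.
Proof.
exists (fun=> setT), setT; split => //; first by exists 0%N.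
by rewrite preimage_setT setTI; apply/seteqP; split.
Qed.

Lemma cylinders_withoutI k : setI_closed (cylinders_without k).
Proof.
move=> _ _ [A [B [mA mB Ak [N AN] ->]]] [A' [B' [mA' mB' Ak' [N' AN'] ->]]].
exists (fun i => A i `&` A' i), (B `&` B'); split.
- by move=> i; exact: measurableI.
- exact: measurableI.
- by rewrite Ak Ak' setIT.
- exists (maxn N N') => i; rewrite geq_max => /andP[Ni N'i].
  by rewrite AN// AN'// setIT.
- apply/seteqP; split => om /=.
    by move=> [[? h] [? h']]; split=> // i _; split; [exact: h|exact: h'].
  by move=> [[? ?] h]; split; split=> // i _; case: (h i I).
Qed.

Let bigcap_iota (A : nat -> set T) N : (forall i, (N <= i)%N -> A i = setT) ->
  \bigcap_i (Zs i @^-1` A i) = \big[setI/setT]_(i <- iota 0 N) (Zs i @^-1` A i).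
Proof.
move=> AN; rewrite -bigcap_seq; apply/seteqP; split => om h i /=.
  by move=> _; exact: h.
move=> _; have [Ni|iN] := leqP N i; first by rewrite /= AN.
by apply: h; rewrite /= mem_iota.
Qed.

Lemma independent_cylinders_without k E C : cylinders_without k E -> measurable C ->
  P (E `&` Zs k @^-1` C) = (P E * P (Zs k @^-1` C))%E.
Proof.
move=> [A [B [mA mB Ak [N0 AN0] ->]]] mC.
(* [N] is pushed beyond [k] so that slot [k] is among the finitely many factors. *)
pose N := maxn N0 k.+1.
have AN i : (N <= i)%N -> A i = setT.
  by rewrite geq_max => /andP[? _]; exact: AN0.
have kN : k \in iota 0 N by rewrite mem_iota /= leq_max leqnn orbT.
(* Slot [k] being free, intersecting with the event on [Zs k] amounts to filling it with [C]. *)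
pose A' i := if i == k then C else A i.
have mA' i : measurable (A' i) by rewrite /A'; case: ifP.
have AN' i : (N <= i)%N -> A' i = setT.
  move=> Ni; rewrite /A'; case: eqP => [ik|_]; last exact: AN.
  by move: Ni; rewrite ik geq_max ltnn andbF.
have EC : (W @^-1` B `&` \bigcap_i (Zs i @^-1` A i)) `&` Zs k @^-1` C =
          W @^-1` B `&` \bigcap_i (Zs i @^-1` A' i).
  apply/seteqP; split => om /=.
    move=> [[? h] ?]; split => // i _; rewrite /= /A'.
    by case: eqP => [->//|_]; exact: h.
  move=> [? h]; split; [split=> // i _|].
    by have := h i I; rewrite /= /A'; case: eqP => // -> _; rewrite Ak.
  by have := h k I; rewrite /= /A' eqxx.
have fE F : measurable F -> P F = (fine (P F))%:E.
  by move=> mF; rewrite fineK ?fin_num_measure.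
have mcap (F : nat -> set T) : (forall i, measurable (F i)) ->
    measurable (W @^-1` B `&` \bigcap_i (Zs i @^-1` F i)).
  move=> mF; apply: measurableI; first exact: mpreW.
  by apply: bigcapT_measurable => i; exact: mpreZ.
rewrite EC fE; last exact: mcap.
rewrite [X in (X * _)%E]fE; last exact: mcap.
rewrite [X in (_ * X)%E]fE; last exact: mpreZ.
rewrite -EFinM (bigcap_iota AN) (bigcap_iota AN') !indepZW ?iota_uniq//.
rewrite (bigD1_seq k) ?iota_uniq//= [in RHS](bigD1_seq k) ?iota_uniq//=.
rewrite {1}/A' eqxx Ak preimage_setT probability_setT mul1r.
congr (_%:E); rewrite -mulrA; congr (_ * _); rewrite mulrC; congr (_ * _).
by apply: eq_bigr => i ik; rewrite /A' (negbTE ik).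
Qed.

Lemma measurable_Zs_without k j : j != k ->
  measurable_fun setT (Zs j : g_sigma_algebraType (cylinders_without k) -> T).
Proof.
move=> jk _ A mA; rewrite setTI; apply: sub_sigma_algebra.
exists (fun i => if i == j then A else setT), setT; split => //.
- by move=> i; case: ifP.
- by rewrite eq_sym (negbTE jk).
- by exists j.+1 => i; case: eqP => // ->; rewrite ltnn.
- rewrite preimage_setT setTI; apply/seteqP; split => om /=.
    by move=> ? i _ /=; case: eqP => // ->.
  by move=> /(_ j I); rewrite /= eqxx.
Qed.

Lemma measurable_W_without k :
  measurable_fun setT (W : g_sigma_algebraType (cylinders_without k) -> Y).
Proof.
move=> _ A mA; rewrite setTI; apply: sub_sigma_algebra.
exists (fun=> setT), A; split => //; first by exists 0%N.
by apply/seteqP; split => om /=; [move=> ?; split|case].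
Qed.

Context (dS : measure_display) (S : measurableType dS).

Lemma expectation_prod_le (zeta : Om -> S) (Phi : S * T -> R) (C : R) (s : seq nat) :
  measurable_fun setT Phi -> (forall z, 0 <= Phi z) -> 0 <= C -> uniq s ->
  measurable_fun setT zeta ->
  (forall k, k \in s ->
     measurable_fun setT (zeta : g_sigma_algebraType (cylinders_without k) -> S)) ->
  (forall k z, k \in s -> (\int[P]_om (Phi (z, Zs k om))%:E <= C%:E)%E) ->
  (\int[P]_om (\prod_(k <- s) Phi (zeta om, Zs k om))%:E <= (C ^+ size s)%:E)%E.
Proof.
move=> mPhi Phi0 C0 + mz.
have mPz k : measurable_fun setT (fun om => Phi (zeta om, Zs k om)).
  by apply: measurableT_comp => //; exact: measurable_fun_pair.
elim: s => [_ _ _|k s IH /= /andP[ks us] mzs PhiC].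
  under eq_integral do rewrite big_nil.
  by rewrite integral_cst//= probability_setT mule1 expr0.
have js j : j \in s -> j != k by move=> jin; apply: contraNneq ks => <-.
pose OmG := g_sigma_algebraType (cylinders_without k).
pose f (q : OmG * T) : \bar R :=
  (Phi (zeta q.1, q.2) * \prod_(j <- s) Phi (zeta q.1, Zs j q.1))%:E.
have mzk : measurable_fun setT (zeta : OmG -> S) by apply: mzs; rewrite mem_head.
have mf : measurable_fun setT f.
  apply/measurable_EFinP; apply: measurable_funM.
    apply: measurableT_comp => //; apply: measurable_fun_pair => //.
    exact: (measurableT_comp mzk).
  apply: measurable_prod => j /js jk.
  apply: measurableT_comp => //; apply: measurable_fun_pair => //.
    exact: (measurableT_comp mzk).
  exact: (measurableT_comp (measurable_Zs_without jk)).
have prod0 om : 0 <= \prod_(j <- s) Phi (zeta om, Zs j om) by exact: prodr_ge0.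
have f0 q : (0 <= f q)%E by rewrite lee_fin mulr_ge0.
have mprod : measurable_fun setT (fun om => \prod_(j <- s) Phi (zeta om, Zs j om)).
  by apply: measurable_prod => j.
under eq_integral do rewrite big_cons -[(_ * _)%:E]/(f (_, _)).
rewrite (@integral_independent _ _ _ P _ _ (cylinders_without k))//; first last.
- by move=> ? ?; exact: independent_cylinders_without.
- exact: cylinders_withoutI.
- exact: cylinders_withoutT.
- exact: measurable_cylinders_without.
apply: (@le_trans _ _ (\int[P]_om (C%:E * (\prod_(j <- s) Phi (zeta om, Zs j om))%:E))%E).
  apply: ge0_le_integral => //.
  - by move=> om _; apply: integral_ge0.
  - exact: (@measurable_integral_independent _ _ _ P _ _ (cylinders_without k)
      (Zs k) _ (@measurable_cylinders_without k)).
  - by apply: measurable_funeM; exact/measurable_EFinP.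
  - move=> om _ /=; rewrite /f /=.
    under eq_integral do rewrite mulrC EFinM.
    rewrite ge0_integralZl//; last 3 first.
    + apply/measurable_EFinP; apply: measurableT_comp => //.
      exact: measurable_fun_pair.
    + by move=> ? _; rewrite lee_fin.
    + by rewrite lee_fin.
    rewrite muleC; apply: lee_wpmul2r; first by rewrite lee_fin.
    by apply: PhiC; rewrite mem_head.
rewrite ge0_integralZl//; last 2 first.
- exact/measurable_EFinP.
- by move=> om _; rewrite lee_fin.
rewrite exprS EFinM; apply: lee_wpmul2l; first by rewrite lee_fin.
apply: IH => // [j jin|j z jin]; [apply: mzs|apply: PhiC]; by rewrite inE jin orbT.
Qed.

(** Markov's inequality for the exponential of the sum, conditionally on [zeta]. *)
Lemma chernoff_bound (zeta : Om -> S) (D : set S) (b : S * T -> R) (C M : R) (s : seq nat) :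
  measurable_fun setT b -> measurable D -> 0 <= C -> uniq s ->
  measurable_fun setT zeta ->
  (forall k, k \in s ->
     measurable_fun setT (zeta : g_sigma_algebraType (cylinders_without k) -> S)) ->
  (forall k z, k \in s -> D z ->
     (\int[P]_om (expR (b (z, Zs k om)))%:E <= C%:E)%E) ->
  (P [set om | D (zeta om) /\ (M <= \sum_(k <- s) b (zeta om, Zs k om))%R]
     <= (expR (- M) * C ^+ size s)%:E)%E.
Proof.
move=> mb mD C0 us mz mzs bC.
(* The indicator makes the factor vanish off [D], so the uniform bound is asked for only at frozen
   values in [D]. *)
pose Phi q := \1_D q.1 * expR (b q).
have mPhi : measurable_fun setT Phi.
  apply: measurable_funM; last exact: measurableT_comp.
  by apply: measurableT_comp => //; exact: measurable_indic.
have Phi0 z : 0 <= Phi z by rewrite mulr_ge0 ?expR_ge0.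
set E := [set om | _].
have mbz k : measurable_fun setT (fun om => b (zeta om, Zs k om)).
  by apply: measurableT_comp => //; exact: measurable_fun_pair.
have mE : measurable E.
  rewrite (_ : E = zeta @^-1` D `&`
     (fun om => \sum_(k <- s) b (zeta om, Zs k om)) @^-1` `[M, +oo[); last first.
    by apply/seteqP; split => om /=; rewrite in_itv/= andbT.
  apply: measurableI; rewrite -[X in measurable X]setTI; first exact: mz.
  have ms : measurable_fun setT (fun om => \sum_(k <- s) b (zeta om, Zs k om)).
    by apply: measurable_sum => k.
  exact: ms.
have mprod : measurable_fun setT (fun om => \prod_(j <- s) Phi (zeta om, Zs j om)).
  apply: measurable_prod => j _; apply: measurableT_comp => //.
  exact: measurable_fun_pair.
have h : (\int[P]_om (\prod_(k <- s) Phi (zeta om, Zs k om))%:E <= (C ^+ size s)%:E)%E.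
  apply: expectation_prod_le => // k z ks; rewrite /Phi /=.
  under eq_integral do rewrite EFinM.
  have mbk : measurable_fun setT (fun om => b (z, Zs k om)).
    by apply: measurableT_comp => //; exact: measurable_fun_pair.
  rewrite ge0_integralZl//; last first.
    by apply/measurable_EFinP; exact: (measurableT_comp (@measurable_expR R)).
  rewrite indicE; case: (boolP (z \in D)) => [|_]; last by rewrite mul0e lee_fin.
  by rewrite inE => Dz; rewrite mul1e; exact: bC.
rewrite EFinM; apply: (@le_trans _ _ ((expR (- M))%:E * ((expR M)%:E * P E))%E).
  by rewrite muleA -EFinM -expRD addNr expR0 mul1e.
apply: lee_wpmul2l; first by rewrite lee_fin expR_ge0.
apply: le_trans h; rewrite -integral_cst//.
apply: (@le_trans _ _ (\int[P]_(om in E) (\prod_(k <- s) Phi (zeta om, Zs k om))%:E)%E).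
  apply: ge0_le_integral => //.
  - by move=> om _; rewrite lee_fin expR_ge0.
  - exact/measurable_EFinP/measurable_funTS.
  - move=> om [Dom Mom]; rewrite lee_fin.
    rewrite (eq_bigr (fun k => expR (b (zeta om, Zs k om)))); last first.
      by move=> k _; rewrite /Phi/= indicE mem_set// mul1r.
    by rewrite -expR_sum ler_expR.
apply: ge0_subset_integral => //; first exact/measurable_EFinP.
by move=> om _; rewrite lee_fin; exact: prodr_ge0.
Qed.

End IndependentFamily.

(** * Quantiles as strict mass below a point *)

Section Quantile.
Context {R : realType}.

Lemma le_dquantile (m : nat) (a v : R) (w : 'I_m -> R) (t : 'I_m -> \bar R) :
  (forall j, 0 <= w j) ->
  ((v%:E <= dquantile a w t)%E = (\sum_(j < m) w j * ((t j < v%:E)%E)%:R < a)).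
Proof.
move=> w0; apply/idP/idP => [|ltwa].
- apply: contraTT; rewrite -leNgt => awt.
  (* The maximum [u] of [g] dominates every atom below [v] and is still below [v]. The value [v - 1]
     serves atoms at infinity, atoms not below [v], and the empty family. *)
  pose g j := if t j is r%:E then (if r < v then r else v - 1) else v - 1.
  have gv j : g j < v.
    rewrite /g; case: (t j) => [r||]; rewrite ?ltrBlDr ?ltrDl//.
    by case: ifPn => // _; rewrite ltrBlDr ltrDl.
  pose u := \big[Order.max/v - 1]_(j < m) g j.
  have uv : u < v by apply: bigmax_lt => //; rewrite ltrBlDr ltrDl.
  rewrite -ltNge; apply: (@le_lt_trans _ _ u%:E); last by rewrite lte_fin.
  apply: ereal_inf_lbound; exists u => //=; apply: le_trans awt _.
  rewrite /dcdf; apply: ler_sum => j _; apply: ler_wpM2l => //.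
  rewrite ler_nat; case: (boolP (t j < v%:E)%E) => //= tv.
  suff -> : (t j <= u%:E)%E by [].
  have := le_bigmax (v - 1) g j; rewrite -/u /g.
  by case: (t j) tv => [r|//|_ _]; rewrite ?leNye// lte_fin => -> /=; rewrite lee_fin.
- apply: le_ereal_inf_tmp => _ [u /= au <-]; rewrite lee_fin leNgt.
  apply/negP => uv; move: au; apply/negP; rewrite -ltNge.
  apply: le_lt_trans ltwa; rewrite /dcdf; apply: ler_sum => j _.
  apply: ler_wpM2l => //; rewrite ler_nat.
  case: (boolP (t j <= u%:E)%E) => //= tu.
  by rewrite (le_lt_trans tu)// lte_fin.
Qed.

End Quantile.

(** * Deterministic estimates for the localized ranks and [alpha_tilde] *)

Section LocalRanks.
Context {R : realType} {T : Type} (n : nat) (d : T -> T -> R) (h : R).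
Variables (X : 'I_n.+1 -> T) (V : 'I_n.+1 -> R).
Hypothesis h0 : 0 < h.
Hypothesis d0 : forall x y, 0 <= d x y.

Let H i j := localizer d h (X i) (X j).
Let S i := \sum_(k < n.+1) H i k.

Lemma localizer_gt0 (x y : T) : 0 < localizer d h x y.
Proof. exact: expR_gt0. Qed.

Lemma localizer_le1 (x y : T) : localizer d h x y <= 1.
Proof. by rewrite -expR0 ler_expR oppr_le0 divr_ge0// ltW. Qed.

Let S_gt0 i : 0 < S i.
Proof.
rewrite /S (bigD1 i)//= ltr_wpDr ?localizer_gt0//.
by apply: sumr_ge0 => k _; exact/ltW/localizer_gt0.
Qed.

Lemma pH_gt0 i j : 0 < pH d h X i j.
Proof. by rewrite divr_gt0 ?localizer_gt0//; exact: S_gt0. Qed.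

Lemma sum_pH i : \sum_(j < n.+1) pH d h X i j = 1.
Proof. by rewrite -mulr_suml divff// gt_eqF//; exact: S_gt0. Qed.

Definition local_rank (U : 'I_n.+1 -> R) (i : 'I_n.+1) : R :=
  \sum_(j < n.+1) pH d h X i j * (U j < U i)%R%:R.

Lemma score_fracE aa v : score_frac d h X V aa v =
  (n.+1%:R)^-1 * \sum_(i < n.+1) (local_rank (Vrep V v) i < aa)%R%:R.
Proof.
rewrite /score_frac; congr (_ * _); apply: eq_bigr => i _.
rewrite le_dquantile; last by move=> j; exact/ltW/pH_gt0.
congr ((_ < _)%R%:R); apply: eq_bigr => j _.
by rewrite /atoms_i /Vrep; case: ifPn; rewrite lte_fin.
Qed.

(** An atom at [+oo] and an atom at the test score are interchangeable: neither lies strictly below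
    the test score. *)
Lemma le_Fhat_quantile aa : ((V ord_max)%:E <= Fhat_quantile d h X V aa)%E =
  (local_rank V ord_max < aa).
Proof.
rewrite /Fhat_quantile le_dquantile; last by move=> j; exact/ltW/pH_gt0.
congr (_ < _); apply: eq_bigr => j _; congr (_ * _%:R).
by rewrite /atoms_hat; case: eqP => [->|]; rewrite ?ltxx// lte_fin.
Qed.

(** The weight of [i] itself is positive and never counted. *)
Lemma local_rank_lt1 U i : local_rank U i < 1.
Proof.
rewrite -(sum_pH i) /local_rank (bigD1 i)//= [ltRHS](bigD1 i)//= ltxx mulr0.
rewrite ltr_leD ?pH_gt0//; apply: ler_sum => j _.
by rewrite ler_piMr ?lern1 ?leq_b1//; exact/ltW/pH_gt0.
Qed.

Lemma Gamma1 : Gamma d h X 1.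
Proof.
exists ord_max, [set: 'I_n.+1]%SET; rewrite -[LHS](sum_pH ord_max).
by apply: eq_bigl => j; rewrite inE.
Qed.

Lemma Gamma_ge0 aa : Gamma d h X aa -> 0 <= aa.
Proof. by move=> [i [I ->]]; apply: sumr_ge0 => j _; exact/ltW/pH_gt0. Qed.

Variable alpha : R.
Hypothesis alpha01 : 0 < alpha < 1.

Let cand v := [set aa | Gamma d h X aa /\ alpha <= score_frac d h X V aa v].

(** Ensures that [alpha_tilde] is the infimum of a nonempty set and not a default value. *)
Lemma alpha_tilde_candidate v : cand v 1.
Proof.
split; first exact: Gamma1.
rewrite score_fracE (eq_bigr (fun=> 1)); last by move=> i _; rewrite local_rank_lt1.
rewrite sumr_const card_ord mulVf ?pnatr_eq0//.
by case/andP: alpha01 => _ /ltW.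
Qed.

Let cand_lb v : lbound (cand v) 0.
Proof. by move=> aa [/Gamma_ge0]. Qed.

Lemma alpha_tilde_ge0 v : 0 <= alpha_tilde d h X V alpha v.
Proof.
apply: lb_le_inf; last exact: cand_lb.
by exists 1; exact: alpha_tilde_candidate.
Qed.

Lemma alpha_tilde_le v aa : Gamma d h X aa -> alpha <= score_frac d h X V aa v ->
  alpha_tilde d h X V alpha v <= aa.
Proof. by move=> Gaa saa; apply: ge_inf; [exists 0; exact: cand_lb|split]. Qed.

Lemma alpha_tilde_le1 v : alpha_tilde d h X V alpha v <= 1.
Proof. by have [] := alpha_tilde_candidate v; exact: alpha_tilde_le. Qed.

(** Since [Gamma] is a finite set, this form exhibits the event as a finite union, from which
    measurability follows. *)
Lemma alpha_tilde_ltP v r : alpha_tilde d h X V alpha v < r <->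
  exists aa, [/\ Gamma d h X aa, alpha <= score_frac d h X V aa v & aa < r].
Proof.
split=> [|[aa [? ? aar]]]; last by apply: le_lt_trans aar; exact: alpha_tilde_le.
move=> /(inf_lt (ex_intro _ 1 (alpha_tilde_candidate v)))[aa [? ?] ?].
by exists aa.
Qed.

Variables (U : 'I_n.+1 -> R) (eps : R).
Hypothesis U01 : forall i, 0 <= U i <= 1.
Hypothesis eps_gt0 : 0 < eps.
(* The margin 2 absorbs the terms j = i and j = n + 1 that are left out of the sum. *)
Hypothesis row_small : forall (i : 'I_n.+1) (b : bool),
  \sum_(j < n.+1 | (j != i) && (j != ord_max))
     H i j * ((-1) ^+ b * ((V j < V i)%R%:R - U i) - eps) < - 2.

(** [V'] may change the test score, which the truncated row never reads; this gives uniformity in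
    [v]. The terms put back are at most 1 each, because the localizer and the bracket are. *)
Let full_row_small V' i (b : bool) : (forall j, j != ord_max -> V' j = V j) -> V' i = V i ->
  \sum_(j < n.+1) H i j * ((-1) ^+ b * ((V' j < V' i)%R%:R - U i) - eps) < 0.
Proof.
move=> V'E V'i; rewrite (bigID (fun j => (j != i) && (j != ord_max)))/=.
rewrite -[ltRHS](addNr 2); apply: ltr_leD.
  rewrite (eq_bigr (fun j => H i j * ((-1) ^+ b * ((V j < V i)%R%:R - U i) - eps))).
    exact: row_small.
  by move=> j /andP[_ jm]; rewrite V'i V'E.
apply: (@le_trans _ _ (\sum_(j < n.+1 | ~~ ((j != i) && (j != ord_max))) 1)).
  apply: ler_sum => j _; have H0 := localizer_gt0 (X i) (X j).
  have H1 := localizer_le1 (X i) (X j).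
  have /andP[U0 U1] := U01 i; rewrite -[leRHS]mul1r.
  have [x0|/ltW x0] := leP 0 ((-1) ^+ b * ((V' j < V' i)%R%:R - U i) - eps); last first.
    by apply: (@le_trans _ _ 0); rewrite ?mul1r// mulr_ge0_le0// ltW.
  apply: ler_pM => //; first exact: ltW.
  clear x0; have e0 := eps_gt0.
  by case: b; case: (V' j < V' i); rewrite /= ?expr1 ?expr0 ?mulr1n ?mulr0n; lra.
rewrite sumr_const -[2]/(2%:R) ler_nat.
rewrite (eq_card (_ : _ =i pred2 i ord_max)); last first.
  by move=> j; rewrite [RHS]inE unfold_in /= negb_and !negbK.
by rewrite card2; case: (i != ord_max).
Qed.

(** The full row sum equals [S i] times the signed deviation minus [eps]; as [S i] is positive, the
    two signs give the two sides of the absolute value. *)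
Lemma local_rank_close V' i : (forall j, j != ord_max -> V' j = V j) -> V' i = V i ->
  `|local_rank V' i - U i| < eps.
Proof.
move=> V'E V'i.
have rankE : \sum_(j < n.+1) H i j * (V' j < V' i)%R%:R = S i * local_rank V' i.
  rewrite /local_rank mulr_sumr; apply: eq_bigr => j _.
  by rewrite /pH -/(H i j) -/(S i) mulrA mulrCA divff ?mulr1// gt_eqF.
have sumE (c : R) : \sum_(j < n.+1) H i j * (c * ((V' j < V' i)%R%:R - U i) - eps) =
    S i * (c * (local_rank V' i - U i) - eps).
  transitivity (c * (\sum_(j < n.+1) H i j * (V' j < V' i)%R%:R)
                - (c * U i + eps) * S i).
    rewrite /S !mulr_sumr -sumrB; apply: eq_bigr => j _; ring.
  by rewrite rankE; ring.
have b1 := full_row_small false V'E V'i; have b2 := full_row_small true V'E V'i.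
move: b1 b2; rewrite !sumE !pmulr_rlt0// expr1 expr0.
by rewrite ltr_norml; lra.
Qed.

(** Adding the two signs cancels the ranks and leaves [eps * S' > 2], whereas each numerator is at
    most 1. *)
Lemma pH_small i j : pH d h X i j <= eps.
Proof.
have b1 := row_small i false; have b2 := row_small i true.
pose S' := \sum_(k < n.+1 | (k != i) && (k != ord_max)) H i k.
have : - (2 * eps * S') < - 4.
  rewrite (_ : - 4 = - 2 + - 2); last by ring.
  apply: le_lt_trans (ltrD b1 b2); rewrite -big_split/= /S' mulr_sumr -sumrN.
  by apply: ler_sum => k _; rewrite expr1 expr0; lra.
have S'S : S' <= S i.
  rewrite /S (bigID (fun k => (k != i) && (k != ord_max)))/= lerDl.
  by apply: sumr_ge0 => k _; exact/ltW/localizer_gt0.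
move=> h4; have eS : 1 <= eps * S i.
  by apply: (@le_trans _ _ (eps * S')); [lra|rewrite ler_pM2l].
rewrite ler_pdivrMr; last exact: S_gt0.
by apply: le_trans eS; exact: localizer_le1.
Qed.

Hypothesis eps_small : alpha + 4 * eps <= 1.
(** [b = false] says that few [U i] lie below [alpha - 2 * eps], [b = true] that many lie below
    [alpha + 2 * eps]. *)
Hypothesis lln_small : forall b : bool,
  \sum_(i < n.+1 | i != ord_max)
    ((-1) ^+ b * ((U i < alpha + (-1) ^+ (~~ b) * (2 * eps))%R%:R
                   - (alpha + (-1) ^+ (~~ b) * (2 * eps))) - eps) < - 2.

Let Vrep_close v i : i != ord_max -> `|local_rank (Vrep V v) i - U i| < eps.
Proof.
move=> im; apply: local_rank_close; last by rewrite /Vrep (negbTE im).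
by move=> j jm; rewrite /Vrep (negbTE jm).
Qed.

Let sum_cst (c : R) : \sum_(i < n.+1 | i != ord_max) c = n%:R * c.
Proof.
by rewrite sumr_const cardC1 card_ord mulr_natl.
Qed.

Let nR : n.+1%:R = n%:R + 1 :> R. Proof. by rewrite -natr1. Qed.

(** At a level below [alpha - 3 * eps], every counted calibration row has [U i < alpha - 2 * eps],
    so the count is below [n * (alpha - eps) - 2]; the test row adds at most 1, which the margin
    covers. *)
Lemma alpha_tilde_lower v : alpha - 3 * eps <= alpha_tilde d h X V alpha v.
Proof.
apply: lb_le_inf; first by exists 1; exact: alpha_tilde_candidate.
move=> aa [_]; apply: contraTT; rewrite -!ltNge => aa3.
rewrite score_fracE mulrC ltr_pdivrMr// (bigD1 ord_max)//=.
have := lln_small false; rewrite expr0 /= expr1.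
under eq_bigr do rewrite mul1r -addrA -opprD.
rewrite sumrB sum_cst => lln.
have le1 : (local_rank (Vrep V v) ord_max < aa)%R%:R <= 1 :> R by rewrite lern1 leq_b1.
have le2 : \sum_(i < n.+1 | i != ord_max) (local_rank (Vrep V v) i < aa)%R%:R <=
           \sum_(i < n.+1 | i != ord_max) (U i < alpha + -1 * (2 * eps))%R%:R :> R.
  apply: ler_sum => i im; rewrite ler_nat; have := Vrep_close v im.
  rewrite ltr_norml => /andP[h1 h2].
  case: (boolP (_ < aa)) => //= h3; rewrite (_ : _ < _)//; lra.
have n0 : 0 <= n%:R * eps :> R by rewrite mulr_ge0// ltW.
have /andP[a0 _] := alpha01.
rewrite nR; apply: le_lt_trans (lerD le1 le2) _.
move: lln; set s := \sum_(i < _ | _) _; nra.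
Qed.

(** Partial sums of the last row climb from 0 to 1 in steps of at most [eps], so the first one to
    reach [alpha + 3 * eps] is an element of [Gamma] not above [alpha + 4 * eps]. At that level more
    than [n * (alpha + eps) + 2] rows are counted. *)
Lemma alpha_tilde_upper v : alpha_tilde d h X V alpha v <= alpha + 4 * eps.
Proof.
have e0 := eps_gt0; have e4 := eps_small.
pose Q m := \sum_(k < n.+1 | (k < m)%N) pH d h X ord_max k.
have QT : alpha + 3 * eps <= Q n.+1.
  rewrite /Q (eq_bigl predT); last by move=> k; rewrite ltn_ord.
  by rewrite sum_pH; lra.
have Q0 : Q 0%N = 0 by rewrite /Q big1.
have QS m : (m <= n)%N -> Q m.+1 <= Q m + eps.
  move=> mn; rewrite /Q (bigD1 (Ordinal (mn : (m < n.+1)%N)))//= addrC.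
  rewrite lerD ?pH_small// le_eqVlt; apply/orP; left; apply/eqP.
  by apply: eq_bigl => k; rewrite ltnS -val_eqE /= ltn_neqAle andbC.
have [|m Qm mmin] := @ex_minnP (fun m => alpha + 3 * eps <= Q m); first by exists n.+1.
have mn : (m <= n.+1)%N by exact: mmin.
have Qle : Q m <= alpha + 4 * eps.
  case: m Qm mmin mn => [|m] Qm mmin mn.
    by rewrite Q0; case/andP: alpha01 => a0 _; lra.
  have : Q m < alpha + 3 * eps.
    by rewrite ltNge; apply/negP => /mmin; rewrite ltnn.
  by have := QS m mn; lra.
apply: le_trans Qle; apply: alpha_tilde_le.
  exists ord_max, [set k : 'I_n.+1 | (k < m)%N]%SET.
  by apply: eq_bigl => k; rewrite inE.
rewrite score_fracE mulrC ler_pdivlMr// (bigD1 ord_max)//=.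
have := lln_small true; rewrite /= expr1 expr0.
rewrite (eq_bigr (fun i => (alpha + eps) - (U i < alpha + 1 * (2 * eps))%R%:R)); last first.
  by move=> i _; ring.
rewrite sumrB sum_cst => lln.
have le1 : 0 <= (local_rank (Vrep V v) ord_max < Q m)%R%:R :> R by [].
have le2 : \sum_(i < n.+1 | i != ord_max) (U i < alpha + 1 * (2 * eps))%R%:R <=
           \sum_(i < n.+1 | i != ord_max) (local_rank (Vrep V v) i < Q m)%R%:R :> R.
  apply: ler_sum => i im; rewrite ler_nat; have := Vrep_close v im.
  rewrite ltr_norml => /andP[h1 h2].
  case: (boolP (U i < _)) => //= h3; rewrite (_ : _ < _)//; lra.
have n0 : 0 <= n%:R * eps :> R by rewrite mulr_ge0// ltW.
have /andP[_ a1] := alpha01.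
rewrite nR; apply: le_trans (lerD le1 le2).
move: lln; set s := \sum_(i < _ | _) _; nra.
Qed.

Lemma alpha_tilde_close v : `|alpha_tilde d h X V alpha v - alpha| <= 4 * eps.
Proof.
by rewrite ler_norml; have := alpha_tilde_lower v; have := alpha_tilde_upper v; lra.
Qed.

Lemma true_rank_close : `|local_rank V ord_max - U ord_max| < eps.
Proof. exact: local_rank_close. Qed.

End LocalRanks.

(** * Reducing the supremum over [v] to countably many values *)

Section RankPatterns.
Context {R : realType} {T : Type} (n : nat) (d : T -> T -> R) (h : R).
Variables (X : 'I_n.+1 -> T) (V : 'I_n.+1 -> R).
Variable alpha : R.
Hypothesis alpha01 : 0 < alpha < 1.

(** The score fraction sees [v] only through its order relative to the calibration scores. *)
Lemma alpha_tilde_pattern v v' :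
  (forall j, j != ord_max -> ((V j < v) = (V j < v')) /\ ((v < V j) = (v' < V j))) ->
  alpha_tilde d h X V alpha v = alpha_tilde d h X V alpha v'.
Proof.
move=> vv'; rewrite /alpha_tilde; congr inf; apply/seteqP.
suff E aa : score_frac d h X V aa v = score_frac d h X V aa v'.
  by split => aa /=; rewrite E.
rewrite !score_fracE//; congr (_ * _); apply: eq_bigr => i _.
congr ((_ < _)%R%:R); apply: eq_bigr => j _; congr (_ * _%:R).
rewrite /Vrep; have [jm|jm] := eqVneq j ord_max; have [im|im] := eqVneq i ord_max.
- by rewrite !ltxx.
- by have [_ ->] := vv' _ im.
- by have [-> _] := vv' _ jm.
- by [].
Qed.

Lemma pattern_representative v : (exists j, v = V j) \/
  exists q : rat, forall j,
    ((V j < v) = (V j < ratr q)) /\ ((v < V j) = (ratr q < V j)).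
Proof.
have [[j vE]|nV] := pselect (exists j, v = V j); first by left; exists j.
right; pose g j := if V j < v then V j else v - 1.
(* [u] is at least every score below [v]; a rational strictly between [u] and [v] has the same order
   pattern as [v]. *)
pose u := \big[Order.max/v - 1]_(j < n.+1) g j.
have uv : u < v.
  apply: bigmax_lt => [|j _]; rewrite /g ?ltrBlDr ?ltrDl//.
  by case: ifPn => // _; rewrite ltrBlDr ltrDl.
have /rat_in_itvoo[q] := uv; rewrite inE /= => /itvP q_; exists q => j.
have [jv|vj|vj] := ltgtP (V j) v.
- have jq : V j < ratr q.
    apply: (@le_lt_trans _ _ u); last by rewrite q_.
    by have := le_bigmax (v - 1) g j; rewrite /g jv.
  by rewrite jq; split => //; rewrite ltNge (ltW jq).
- have qj : ratr q < V j by apply: lt_trans vj; rewrite q_.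
  by rewrite qj; split => //; rewrite ltNge (ltW qj).
- by exfalso; apply: nV; exists j.
Qed.

Lemma forall_alpha_tilde (Q : R -> Prop) :
  (forall v, Q (alpha_tilde d h X V alpha v)) <->
  (forall q : rat, Q (alpha_tilde d h X V alpha (ratr q))) /\
  (forall j, Q (alpha_tilde d h X V alpha (V j))).
Proof.
split=> [Qv|[Qq Qj] v]; first by split.
have [[j ->]//|[q vq]] := pattern_representative v.
by rewrite (@alpha_tilde_pattern v (ratr q)).
Qed.

Let dev v : R := `|alpha_tilde d h X V alpha v - alpha|.

Lemma has_sup_dev : has_sup (range dev).
Proof.
split; first by exists (dev 0), 0.
exists 1 => _ [v _ <-]; rewrite /dev ler_norml.
have := alpha_tilde_ge0 d h X V alpha01 v; have := alpha_tilde_le1 d h X V alpha01 v.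
by case/andP: alpha01 => ? ? ? ?; lra.
Qed.

Lemma sup_dev_ltP eps : sup (range dev) < eps <->
  exists k : nat, (forall q : rat, dev (ratr q) <= eps - k.+1%:R^-1) /\
                  (forall j, dev (V j) <= eps - k.+1%:R^-1).
Proof.
split=> [seps|[k /(forall_alpha_tilde (fun a => `|a - alpha| <= eps - k.+1%:R^-1)).2 hk]]; last first.
  apply: (@le_lt_trans _ _ (eps - k.+1%:R^-1)); last by rewrite ltrBlDr ltrDl invr_gt0.
  by apply: ge_sup; [exists (dev 0), 0|move=> _ [v _ <-]; exact: hk].
pose k := Num.truncn (eps - sup (range dev))^-1; exists k.
have ke : k.+1%:R^-1 <= eps - sup (range dev).
  rewrite -[leRHS]invrK lef_pV2 ?posrE ?invr_gt0 ?subr_gt0//.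
  by rewrite ltW// truncnS_gt.
have hv v : dev v <= eps - k.+1%:R^-1.
  apply: (@le_trans _ _ (sup (range dev))); last by rewrite lerBrDr addrC -lerBrDr.
  by apply: ub_le_sup; [case: has_sup_dev|exists v].
by split.
Qed.

End RankPatterns.

(** * Measurability of the events in the limits *)

Section RankMeasurability.
Context {R : realType} (dO dT : measure_display).
Context (Om : measurableType dO) (T : measurableType dT).
Variables (n : nat) (d : T -> T -> R) (h : R).
Hypothesis md : measurable_fun setT (fun xx : T * T => d xx.1 xx.2).
Variable alpha : R.
Hypothesis alpha01 : 0 < alpha < 1.
Variables (X : Om -> 'I_n.+1 -> T) (V : Om -> 'I_n.+1 -> R).
Hypothesis mX : forall i, measurable_fun setT (X^~ i).
Hypothesis mV : forall i, measurable_fun setT (V^~ i).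

Lemma measurable_boolR (b : Om -> bool) : measurable_fun setT b ->
  measurable_fun setT (fun om => (b om)%:R : R).
Proof.
move=> mb; rewrite (_ : (fun om => _) = (fun om => if b om then 1 else 0)).
  by apply: measurable_fun_ifT => //; exact: measurable_cst.
by apply/funext => om; case: (b om).
Qed.

Lemma measurable_set_bool (b : Om -> bool) : measurable_fun setT b ->
  measurable [set om | b om].
Proof. by move=> mb; rewrite -[X in measurable X]setTI; exact: (mb measurableT [set true]). Qed.

Lemma measurable_localizer (h' : R) :
  measurable_fun setT (fun xx : T * T => localizer d h' xx.1 xx.2).
Proof.
apply: measurableT_comp => //; apply: measurableT_comp => //.
by apply: measurable_funM => //; exact: measurable_cst.
Qed.

Let mH i j : measurable_fun setT (fun om => localizer d h (X om i) (X om j)).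
Proof.
have mp : measurable_fun setT (fun om => (X om i, X om j)).
  exact: measurable_fun_pair.
exact: (measurableT_comp (measurable_localizer h) mp).
Qed.

Lemma measurable_pH i j : measurable_fun setT (fun om => pH d h (X om) i j).
Proof.
pose S om := \sum_(k < n.+1) localizer d h (X om i) (X om k).
have S0 om : 0 < S om.
  rewrite /S (bigD1 i)//= ltr_wpDr ?localizer_gt0//.
  by apply: sumr_ge0 => k _; exact/ltW/localizer_gt0.
(* The division becomes a product with [expR (- ln (S om))], legitimate since [S om] is positive,
   and thus a composition of measurable maps. *)
rewrite (_ : (fun om => _) =
    (fun om => localizer d h (X om i) (X om j) * expR (- ln (S om)))); last first.
  by apply/funext => om; rewrite expRN lnK// posrE.
apply: measurable_funM => //; apply: measurableT_comp => //.
apply: measurableT_comp => //; apply: measurableT_comp => //.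
exact: measurable_sum.
Qed.

Lemma measurable_local_rank (U : Om -> 'I_n.+1 -> R) i :
  (forall j, measurable_fun setT (U^~ j)) ->
  measurable_fun setT (fun om => local_rank d h (X om) (U om) i).
Proof.
move=> mU; apply: measurable_sum => j; apply: measurable_funM.
  exact: measurable_pH.
by apply: measurable_boolR; exact: measurable_fun_ltr.
Qed.

Lemma measurable_score_frac (aa v : Om -> R) :
  measurable_fun setT aa -> measurable_fun setT v ->
  measurable_fun setT (fun om => score_frac d h (X om) (V om) (aa om) (v om)).
Proof.
move=> maa mv; rewrite (_ : (fun om => _) = (fun om =>
  (n.+1%:R)^-1 * \sum_(i < n.+1) (local_rank d h (X om) (Vrep (V om) (v om)) i < aa om)%R%:R)).
  apply: measurable_funM; first exact: measurable_cst.
  apply: measurable_sum => i; apply: measurable_boolR; apply: measurable_fun_ltr => //.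
  by apply: measurable_local_rank => j; rewrite /Vrep; case: eqP.
by apply/funext => om; rewrite score_fracE.
Qed.

Lemma measurable_alpha_tilde (v : Om -> R) : measurable_fun setT v ->
  measurable_fun setT (fun om => alpha_tilde d h (X om) (V om) alpha (v om)).
Proof.
move=> mv; apply: (measurability _ (RGenInftyO.measurableE R)) => _ [_ [r ->] <-].
rewrite setTI.
pose c (i : 'I_n.+1) (I : {set 'I_n.+1}) om := \sum_(k in I) pH d h (X om) i k.
(* The elements of [Gamma] move with [om], but their labels [(i, I)] range over a fixed finite
   set. *)
rewrite (_ : _ @^-1` _ = \bigcup_(iI in [set: 'I_n.+1 * {set 'I_n.+1}])
   ([set om | alpha <= score_frac d h (X om) (V om) (c iI.1 iI.2 om) (v om)] `&`
    [set om | c iI.1 iI.2 om < r])).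
  apply: fin_bigcup_measurable => [|[i I] _ /=].
    exact: finite_finset.
  have mc : measurable_fun setT (c i I).
    rewrite /c; under eq_fun do rewrite big_mkcond /=.
    by apply: measurable_sum => k; case: (k \in I) => //; exact: measurable_pH.
  apply: measurableI; apply: measurable_set_bool.
    by apply: measurable_fun_ler => //; exact: measurable_score_frac.
  exact: measurable_fun_ltr.
apply/seteqP; split => om /=.
  rewrite in_itv/= => /(alpha_tilde_ltP _ _ _ _ alpha01)[aa [[i [I ->]] ? ?]].
  by exists (i, I).
move=> [[i I] _ [/= ? ?]]; rewrite in_itv/=.
by apply/(alpha_tilde_ltP _ _ _ _ alpha01); exists (c i I om); split => //; exists i, I.
Qed.

Lemma measurable_conf_set_event :
  measurable [set om | conf_set d h (X om) (V om) alpha (V om ord_max)].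
Proof.
rewrite (_ : [set om | _] = [set om | local_rank d h (X om) (V om) ord_max <
    alpha_tilde d h (X om) (V om) alpha (V om ord_max)]).
  apply: measurable_set_bool; apply: measurable_fun_ltr.
    exact: measurable_local_rank.
  exact: measurable_alpha_tilde.
by apply/seteqP; split => om /=; rewrite /conf_set /= le_Fhat_quantile.
Qed.

Lemma measurable_Fhat_event aa :
  measurable [set om | ((V om ord_max)%:E <= Fhat_quantile d h (X om) (V om) aa)%E].
Proof.
rewrite (_ : [set om | _] = [set om | local_rank d h (X om) (V om) ord_max < aa]).
  by apply: measurable_set_bool; apply: measurable_fun_ltr => //; exact: measurable_local_rank.
by apply/seteqP; split => om /=; rewrite le_Fhat_quantile.
Qed.

Lemma measurable_sup_event eps : measurable [set om | sup (range (fun v : R =>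
  `|alpha_tilde d h (X om) (V om) alpha v - alpha|)) < eps].
Proof.
pose dev v om := `|alpha_tilde d h (X om) (V om) alpha (v om) - alpha|.
have mdev (v : Om -> R) c : measurable_fun setT v -> measurable [set om | dev v om <= c].
  move=> mv; apply: measurable_set_bool; apply: measurable_fun_ler => //.
  apply: measurableT_comp => //; apply: measurable_funB => //.
  exact: measurable_alpha_tilde.
rewrite (_ : [set om | _] = \bigcup_(k : nat)
   ((~` \bigcup_(q : rat) ~` [set om | dev (fun=> ratr q) om <= eps - k.+1%:R^-1]) `&`
    (\bigcap_(j in [set: 'I_n.+1]) [set om | dev (V^~ j) om <= eps - k.+1%:R^-1]))).
  apply: bigcupT_measurable => k; apply: measurableI.
    apply: measurableC; apply: bigcupT_measurable_rat => q; apply: measurableC.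
    by apply: mdev; exact: measurable_cst.
  by apply: fin_bigcap_measurable => [|j _]; [exact: finite_finset|exact: mdev].
apply/seteqP; split => om /=.
  move=> /(sup_dev_ltP _ _ _ _ alpha01)[k [hq hj]]; exists k => //; split => [[q _]|j _] /=.
    by apply; exact: hq.
  exact: hj.
move=> [k _ [hq hj]]; apply/(sup_dev_ltP _ _ _ _ alpha01); exists k; split => [q|j].
  by apply: contrapT => hn; apply: hq; exists q.
exact: hj.
Qed.

End RankMeasurability.

(** * Continuous distribution functions and the probability integral transform *)

Section ContinuousCdf.
Context (R : realType) (dY : measure_display) (Y : measurableType dY).
Variables (m : {measure set Y -> \bar R}) (f : Y -> R).
Hypothesis m1 : m setT = 1%E.
Hypothesis mf : measurable_fun setT f.

Definition cdf_of (v : R) : R := fine (m [set y | f y <= v]).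
Hypothesis cF : continuous cdf_of.

Let mle v : measurable [set y | f y <= v].
Proof.
rewrite (_ : [set y | _] = setT `&` f @^-1` `]-oo, v]); first exact: mf.
by rewrite setTI; apply/seteqP; split => y /=; rewrite in_itv.
Qed.

Let mlt v : measurable [set y | f y < v].
Proof.
rewrite (_ : [set y | _] = setT `&` f @^-1` `]-oo, v[); first exact: mf.
by rewrite setTI; apply/seteqP; split => y /=; rewrite in_itv.
Qed.

Let m_le1 A : measurable A -> (m A <= 1)%E.
Proof. by move=> mA; rewrite -m1; apply: le_measure; rewrite ?inE. Qed.

Let m_fin A : measurable A -> m A \is a fin_num.
Proof.
by move=> mA; rewrite ge0_fin_numE//; apply: le_lt_trans (m_le1 mA) _; rewrite ltry.
Qed.

Let FE v : m [set y | f y <= v] = (cdf_of v)%:E.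
Proof. by rewrite /cdf_of fineK// m_fin. Qed.

Lemma cdf_of_itv v : 0 <= cdf_of v <= 1.
Proof. by rewrite -!lee_fin -FE measure_ge0 m_le1. Qed.

Lemma cdf_of_le u v : u <= v -> cdf_of u <= cdf_of v.
Proof.
move=> uv; rewrite -lee_fin -!FE; apply: le_measure; rewrite ?inE//.
by move=> y /= /le_trans; apply.
Qed.

(** Continuity from the left excludes an atom at [v]. The strict form is the one that the local
    ranks require. *)
Lemma cdf_of_lt v : m [set y | f y < v] = (cdf_of v)%:E.
Proof.
have mltv : m [set y | f y < v] = (fine (m [set y | f y < v]))%:E.
  by rewrite fineK// m_fin.
apply/eqP; rewrite eq_le; apply/andP; split.
  by rewrite -FE; apply: le_measure; rewrite ?inE// => y /= /ltW.
rewrite mltv lee_fin; apply/ler_addgt0Pl => e e0.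
have /cvgrPdist_lt/(_ _ e0)[/= dl dl0 near_v] := @cF v.
have hv : `|v - (v - dl / 2)| < dl.
  by rewrite opprB addrC subrK gtr0_norm ?divr_gt0// ltr_pdivrMr// ltr_pMr// ltr1n.
have := near_v _ hv; rewrite /= ltr_norml => /andP[_].
rewrite ltrBlDr => /ltW h; apply: le_trans h _.
rewrite lerD2l -lee_fin -mltv -FE; apply: le_measure; rewrite ?inE//.
by move=> y /= /le_lt_trans; apply; rewrite ltrBlDr ltrDl divr_gt0.
Qed.

Let exists_lt a : 0 < a -> exists w, cdf_of w < a.
Proof.
move=> a0; apply/not_existsP => hn.
pose F (n : nat) := [set y | f y <= - n%:R].
have F0 : \bigcap_n F n = set0.
  apply/seteqP; split => // y Fy.
  have := Fy (Num.truncn (- f y)).+1 I; rewrite /F /= lerNr leNgt.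
  by rewrite truncnS_gt.
have : m \o F @ \oo --> m (\bigcap_n F n).
  apply: nonincreasing_cvg_mu.
  - by rewrite ltey_eq m_fin//; exact: mle.
  - by move=> i; exact: mle.
  - by rewrite F0.
  move=> i j ij; apply/subsetPset => y /= /le_trans; apply.
  by rewrite lerN2 ler_nat.
rewrite F0 measure0 => /[dup] cvF /cvg_lim => /(_ (@ereal_hausdorff R)) limF.
have : (a%:E <= limn (m \o F))%E.
  apply: lime_ge; first by apply/cvg_ex; exists 0%E.
  by apply: nearW => n /=; rewrite FE lee_fin leNgt; apply/negP/hn.
by rewrite limF lee_fin leNgt a0.
Qed.

Let exists_gt a : a < 1 -> exists w, a < cdf_of w.
Proof.
move=> a1; apply/not_existsP => hn.
pose F (n : nat) := [set y | f y <= n%:R].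
have F0 : \bigcup_n F n = setT.
  apply/seteqP; split => // y _; exists (Num.truncn (f y)).+1 => //=.
  by rewrite /F /= ltW// truncnS_gt.
have : m \o F @ \oo --> m (\bigcup_n F n).
  apply: nondecreasing_cvg_mu; [by move=> i; exact: mle|by rewrite F0|].
  move=> i j ij; apply/subsetPset => y /= /le_trans; apply.
  by rewrite ler_nat.
rewrite F0 m1 => /[dup] cvF /cvg_lim => /(_ (@ereal_hausdorff R)) limF.
have : (limn (m \o F) <= a%:E)%E.
  apply: lime_le; first by apply/cvg_ex; exists 1%E.
  by apply: nearW => n /=; rewrite FE lee_fin leNgt; apply/negP/hn.
by rewrite limF lee_fin leNgt a1.
Qed.

Let exists_eq a : 0 < a < 1 -> exists w, cdf_of w = a.
Proof.
move=> /andP[a0 a1]; have [lo lo_a] := exists_lt a0; have [hi hi_a] := exists_gt a1.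
have lohi : lo <= hi.
  rewrite leNgt; apply/negP => /ltW/cdf_of_le; rewrite leNgt => /negP; apply.
  exact: lt_trans hi_a.
have [||c _ <-] := @IVT R cdf_of lo hi a lohi; last by exists c.
  exact: continuous_subspaceT.
by rewrite ge_min le_max (ltW lo_a) (ltW hi_a) orbT.
Qed.

(** The distribution function may have flat parts, so the event is sandwiched instead of inverted:
    it lies in [{f <= c}] with [cdf_of c = a] and contains [{f <= c'}] with [cdf_of c' = a - e]. *)
Lemma probability_integral_transform a : 0 < a < 1 ->
  measurable_fun setT (fun y => cdf_of (f y)) ->
  m [set y | cdf_of (f y) < a] = a%:E.
Proof.
move=> a01 mFf; have [c Fc] := exists_eq a01.
have mE : measurable [set y | cdf_of (f y) < a].
  rewrite (_ : [set y | _] = setT `&` (fun y => cdf_of (f y)) @^-1` `]-oo, a[).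
    exact: mFf.
  by rewrite setTI; apply/seteqP; split => y /=; rewrite in_itv.
apply/eqP; rewrite eq_le; apply/andP; split.
  rewrite -Fc -FE; apply: le_measure; rewrite ?inE//; first by rewrite Fc.
  move=> y /=; apply: contraTT; rewrite -leNgt -ltNge => cy.
  exact/cdf_of_le/ltW.
rewrite -[leRHS](@fineK _ (m _)) ?m_fin// lee_fin; apply/ler_addgt0Pl => e e0.
rewrite -lerBlDl.
have [ae0|ae0] := leP (a - e) 0.
  by apply: le_trans ae0 _; exact: fine_ge0.
have [|c' Fc'] := @exists_eq (a - e).
  by rewrite ae0 /=; case/andP: a01 => _ a1; lra.
rewrite -Fc' -lee_fin -FE fineK ?m_fin//; apply: le_measure; rewrite ?inE//.
move=> y /= /cdf_of_le; rewrite Fc' => /le_lt_trans; apply.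
by rewrite ltrBlDr ltrDl.
Qed.

Lemma integral_two_values (A : set Y) (e1 e0 : R) : measurable A -> 0 <= e1 -> 0 <= e0 ->
  (\int[m]_y (if y \in A then e1 else e0)%:E
     = (fine (m A) * e1 + (1 - fine (m A)) * e0)%:E)%E.
Proof.
move=> mA e10 e00.
transitivity (\int[m]_y (e1%:E * (\1_A y)%:E + e0%:E * (\1_(~` A) y)%:E))%E.
  apply: eq_integral => y _; rewrite !indicE in_setC.
  by case: (y \in A) => /=; rewrite ?mule1 ?mule0 ?adde0 ?add0e.
have mAC := measurableC mA.
have mi (B : set Y) : measurable B -> measurable_fun setT (fun y => (\1_B y : R)%:E).
  by move=> mB; apply/measurable_EFinP; exact: measurable_indic.
rewrite ge0_integralD//; last 4 first.
- by move=> y _; rewrite mule_ge0// lee_fin.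
- by apply: measurable_funeM; exact: mi.
- by move=> y _; rewrite mule_ge0// lee_fin.
- by apply: measurable_funeM; exact: mi.
rewrite !ge0_integralZl//; try exact: mi; try (by move=> y _; rewrite lee_fin).
rewrite !integral_indic// !setIT.
have -> : m (~` A) = (1 - fine (m A))%:E.
  rewrite EFinB fineK ?m_fin// -m1 -setTD measureD ?setTI//.
  by rewrite [ltLHS]m1 ltry.
by rewrite -[m A]fineK ?m_fin// -!EFinM -EFinD mulrC (mulrC e0).
Qed.

End ContinuousCdf.

(** * Elementary exponential moment inequalities *)

Section ExponentialBounds.
Context {R : realType}.

(** The product of the right side with [1 - u] is [1 + u ^+ 2 * (1 - 2 * u)], at least 1, and
    [1 - u] is at most [expR (- u)]. *)
Lemma expR_le_quadratic (u : R) : u <= 2^-1 -> expR u <= 1 + u + 2 * u ^+ 2.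
Proof.
move=> u2; have hu := expR_ge1Dx (- u).
have h1 : 1 <= (1 + u + 2 * u ^+ 2) * (1 - u).
  rewrite (_ : _ * _ = 1 + u ^+ 2 * (1 - 2 * u)); last by ring.
  by rewrite lerDl mulr_ge0 ?sqr_ge0//; lra.
have q0 : 0 <= 1 + u + 2 * u ^+ 2 by nra.
have h2 : 1 <= (1 + u + 2 * u ^+ 2) * expR (- u).
  exact: le_trans h1 (ler_wpM2l q0 hu).
have := ler_wpM2l (expR_ge0 u) h2.
by rewrite mulr1 mulrCA -expRD subrr expR0 mulr1.
Qed.

(* [k] and [f] are the probabilities of the event {V' < v} under the laws at the
   two covariates, and [t] is the tilting parameter times the localizer weight. *)
Lemma two_point_mgf_le (k f t eps : R) (b : bool) :
  0 <= k <= 1 -> 0 <= f <= 1 -> 0 <= t <= 4^-1 -> 0 < eps <= 1 ->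
  k * expR (t * ((-1) ^+ b * (1 - f) - eps)) +
    (1 - k) * expR (t * ((-1) ^+ b * (0 - f) - eps))
  <= 1 + t * ((-1) ^+ b * (k - f) - eps) + 8 * t ^+ 2.
Proof.
move=> /andP[k0 k1] /andP[f0 f1] /andP[t0 t1] /andP[e0 e1].
have bnd (c : R) : 0 <= c <= 1 ->
    expR (t * ((-1) ^+ b * (c - f) - eps)) <=
    1 + t * ((-1) ^+ b * (c - f) - eps) + 8 * t ^+ 2.
  move=> /andP[c0 c1]; set w := (-1) ^+ b * (c - f) - eps.
  (* This bound keeps [t * w] below one half and turns the quadratic term into [8 * t ^+ 2]. *)
  have w2 : - 2 <= w <= 2.
    by rewrite /w; case: (b); rewrite /= ?expr1 ?expr0; apply/andP; split; lra.
  have /andP[wl wr] := w2.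
  apply: le_trans (expR_le_quadratic _) _; first by nra.
  rewrite lerD2l exprMn; have : w ^+ 2 <= 4 by nra.
  have := sqr_ge0 t; nra.
(* The bound is affine in [c], so averaging its values at 1 and 0 with weights [k] and [1 - k] gives
   its value at [k]. *)
have b1 := bnd 1; have b0 := bnd 0.
move: b1 b0; rewrite ?ler01 ?lexx => /(_ isT) b1 /(_ isT) b0.
apply: le_trans (lerD (ler_wpM2l k0 b1) (ler_wpM2l _ b0)) _; first by lra.
by rewrite le_eqVlt; apply/orP; left; apply/eqP; ring.
Qed.

(* With tilt [eps / 32] the quadratic term costs a quarter of [eps], and within distance
   [eps / (2 * L)] the Lipschitz bias costs half of it, so a negative drift remains;
   farther points carry weight at most [expR (- (eps / (2 * L) / h))]. *)
Lemma localized_mgf_le (k f dd h L eps : R) (b : bool) :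
  0 <= k <= 1 -> 0 <= f <= 1 -> 0 < eps <= 1 -> 0 < L -> 0 <= dd -> 0 < h ->
  h <= eps / (2 * L) -> `|k - f| <= L * dd ->
  k * expR (eps / 32 * (expR (- (dd / h)) * ((-1) ^+ b * (1 - f) - eps))) +
    (1 - k) * expR (eps / 32 * (expR (- (dd / h)) * ((-1) ^+ b * (0 - f) - eps)))
  <= 1 + eps / 16 * expR (- (eps / (2 * L) / h))
     - (if dd <= h then eps ^+ 2 / 128 * expR (- 1) else 0).
Proof.
move=> k01 f01 e01 L0 dd0 h0 hd kf; rewrite !mulrA.
have /andP[e0 e1] := e01.
set H := expR (- (dd / h)); set w := expR (- (eps / (2 * L) / h)).
have H0 : 0 < H by exact: expR_gt0.
have H1 : H <= 1 by rewrite -expR0 ler_expR oppr_le0 divr_ge0// ltW.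
have w0 : 0 < w by exact: expR_gt0.
have w1 : w <= 1.
  rewrite -expR0 ler_expR oppr_le0 divr_ge0 ?ltW//.
  by rewrite divr_gt0// mulr_gt0.
have [ddd|ddd] := leP dd (eps / (2 * L)).
- apply: le_trans (two_point_mgf_le _ k01 f01 _ e01) _.
    by apply/andP; split; nra.
  have skf : (-1) ^+ b * (k - f) <= eps / 2.
    apply: (@le_trans _ _ `|k - f|).
      by rewrite -[leRHS](normrMsign b) ler_norm.
    apply: le_trans kf _; rewrite mulrC -ler_pdivlMr//.
    by rewrite (le_trans ddd)// le_eqVlt; apply/orP; left; apply/eqP; field; rewrite gt_eqF.
  apply: (@le_trans _ _ (1 - eps / 32 * H * (eps / 4))).
    set t := eps / 32 * H; have t0 : 0 <= t by rewrite /t; nra.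
    have t8 : 8 * t <= eps / 4 by rewrite /t; nra.
    have h1 : t * ((-1) ^+ b * (k - f) - eps) <= t * (- (eps / 2)).
      by apply: ler_wpM2l => //; lra.
    have h2 := ler_wpM2l t0 t8.
    by lra.
  (* Within one bandwidth the weight is at least [expR (- 1)], which makes the drift quantitative;
     between [h] and the cutoff only its sign is kept. *)
  case: ifPn => [ddh|_]; last by nra.
  have He : expR (- 1) <= H by rewrite ler_expR lerN2 ler_pdivrMr// mul1r.
  by nra.
- rewrite ifF; last by apply/negbTE; rewrite -ltNge (le_lt_trans hd).
  have Hw : H <= w.
    by rewrite ler_expR lerN2 ler_pM2r ?invr_gt0// ltW.
  have bnd (c : R) : 0 <= c <= 1 ->
      expR (eps / 32 * H * ((-1) ^+ b * (c - f) - eps)) <= 1 + eps / 16 * w.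
    move=> /andP[c0 c1]; have /andP[f0 f1] := f01.
    have u1 : (-1) ^+ b * (c - f) - eps <= 1.
      by case: (b); rewrite /= ?expr1 ?expr0; lra.
    apply: (@le_trans _ _ (expR (eps / 32 * w))).
      rewrite ler_expR -mulrA; apply: ler_wpM2l; first by lra.
      by apply: le_trans Hw; rewrite ler_piMr// ltW.
    have t0 : 0 <= eps / 32 * w by rewrite mulr_ge0 ?ltW// divr_gt0.
    have t1 : 2 * (eps / 32 * w) <= 1 by nra.
    apply: le_trans (expR_le_quadratic _) _; first by lra.
    have := ler_wpM2l t0 t1; lra.
  have b1 := bnd 1; have b0 := bnd 0.
  move: b1 b0; rewrite ?ler01 ?lexx => /(_ isT) b1 /(_ isT) b0.
  have /andP[k0 k1] := k01; have k1' : 0 <= 1 - k by lra.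
  apply: le_trans (lerD (ler_wpM2l k0 b1) (ler_wpM2l k1' b0)) _.
  by rewrite -mulrDl; lra.
Qed.

End ExponentialBounds.

(** * Exponential moments under the conditional laws *)

Section ConditionalCdf.
Context (R : realType) (dX dY : measure_display).
Context (X : measurableType dX) (Y : measurableType dY).
Context (K : R.-pker X ~> Y) (V : X * Y -> R).
Hypothesis mV : measurable_fun setT V.

(** [K] with the threshold as an idle parameter, so that measurability of section measures applies
    jointly in covariate and threshold. *)
Definition kernel_fst (u : X * R) : {measure set Y -> \bar R} := K u.1.

Let measurable_kernel_fst (A : set Y) : measurable A ->
  measurable_fun [set: X * R] (kernel_fst ^~ A).
Proof.
by move=> mA; exact: (measurableT_comp (measurable_kernel K A mA) (@measurable_fst _ _ _ _)).
Qed.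

HB.instance Definition _ :=
  isKernel.Build _ _ _ _ R kernel_fst measurable_kernel_fst.

Let kernel_fst_setT u : kernel_fst u setT = 1%E.
Proof. exact: prob_kernel. Qed.

HB.instance Definition _ :=
  Kernel_isProbability.Build _ _ _ _ R kernel_fst kernel_fst_setT.

Definition cond_cdf (x : X) (v : R) : R := fine (K x [set y | V (x, y) <= v]).

(** Joint measurability is needed because [U_i] evaluates the distribution function at a random
    covariate and a random score at once. *)
Lemma measurable_cond_cdf :
  measurable_fun setT (fun u : X * R => cond_cdf u.1 u.2).
Proof.
pose E := [set q : (X * R) * Y | V (q.1.1, q.2) <= q.1.2].
have mE : measurable E.
  rewrite (_ : E = setT `&` (fun q : (X * R) * Y => V (q.1.1, q.2) <= q.1.2) @^-1` [set true]).
    apply: measurable_fun_ler => //.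
      apply: measurableT_comp => //; apply: measurable_fun_pair => //.
      exact: measurableT_comp.
    exact: measurableT_comp.
  by rewrite setTI.
have mk : measurable_fun setT (fun u : X * R => kernel_fst u (xsection E u)).
  by apply: measurable_fun_xsection_finite_kernel; rewrite inE.
rewrite (_ : (fun u => _) = fine \o (fun u : X * R => kernel_fst u (xsection E u))).
  exact: measurableT_comp.
by apply/funext => -[x v]; rewrite /cond_cdf /= xsectionE.
Qed.

Lemma measurable_cond_cdf_V : measurable_fun setT (fun z : X * Y => cond_cdf z.1 (V z)).
Proof.
have mp : measurable_fun setT (fun z : X * Y => (z.1, V z)).
  exact: measurable_fun_pair.
exact: (measurableT_comp measurable_cond_cdf mp).
Qed.

Lemma measurable_section_V x : measurable_fun setT (fun y => V (x, y)).
Proof. exact: measurable_fun_pair2. Qed.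

Lemma cond_cdf_itv x v : 0 <= cond_cdf x v <= 1.
Proof.
exact: (@cdf_of_itv R dY Y (K x) (fun y => V (x, y)) (prob_kernel x) (measurable_section_V x)).
Qed.

Variable (PX : probability X R) (D : set X).
Hypothesis mD : measurable D.
Hypothesis PXD : PX D = 1%E.
Hypothesis cVc : forall x, D x -> continuous (cond_cdf x).

Let ae_D : {ae PX, forall x, D x}.
Proof.
exists (~` D); split; [exact: measurableC|by rewrite probability_setC ?PXD ?subee|by []].
Qed.

(** By the integral transform the event has conditional probability exactly [a], so there is no
    bias: the drift [eps ^+ 2 / 32] exceeds the quadratic cost [eps ^+ 2 / 128] with room for
    [eps ^+ 2 / 64]. *)
Lemma lln_mgf_le (a eps : R) (b : bool) : 0 < a < 1 -> 0 < eps <= 1 ->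
  (\int[PX]_x \int[K x]_y
     (expR (eps / 32 * ((-1) ^+ b * ((cond_cdf x (V (x, y)) < a)%R%:R - a) - eps)))%:E
   <= (1 - eps ^+ 2 / 64)%:E)%E.
Proof.
move=> a01 /andP[e0 e1].
set t := eps / 32.
have step x : D x -> (\int[K x]_y
     (expR (t * ((-1) ^+ b * ((cond_cdf x (V (x, y)) < a)%R%:R - a) - eps)))%:E
   <= (1 - eps ^+ 2 / 64)%:E)%E.
  move=> Dx; pose A := [set y | cond_cdf x (V (x, y)) < a].
  have mF : measurable_fun setT (fun y => cond_cdf x (V (x, y))).
    have mp : measurable_fun setT (fun y => (x, V (x, y))).
      by apply: measurable_fun_pair => //; exact: measurable_section_V.
    exact: (measurableT_comp measurable_cond_cdf mp).
  have mA : measurable A.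
    rewrite (_ : A = setT `&` (fun y => cond_cdf x (V (x, y)) < a) @^-1` [set true]).
      exact: measurable_fun_ltr.
    by rewrite setTI.
  have KA : K x A = a%:E.
    exact: (@probability_integral_transform R dY Y (K x) (fun y => V (x, y))
      (prob_kernel x) (measurable_section_V x) (cVc Dx)).
  under eq_integral => y _.
    rewrite (_ : expR _ = if y \in A then expR (t * ((-1) ^+ b * (1 - a) - eps))
       else expR (t * ((-1) ^+ b * (0 - a) - eps))); last first.
      have -> : (y \in A) = (cond_cdf x (V (x, y)) < a) by apply/idP/idP; rewrite inE.
      by case: (_ < a).
    over.
  rewrite integral_two_values ?expR_ge0//; last exact: prob_kernel.
  rewrite KA lee_fin; apply: le_trans (two_point_mgf_le _ _ _ _ _) _.
  - by case/andP: a01 => /ltW -> /ltW ->.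
  - by case/andP: a01 => /ltW -> /ltW ->.
  - by rewrite /t; apply/andP; split; lra.
  - by rewrite e0.
  by rewrite subrr mulr0 /t; nra.
rewrite -[leRHS]mule1 -(@probability_setT _ _ _ PX) -integral_cst//.
apply: ae_ge0_le_integral => //.
- by move=> x _; apply: integral_ge0 => y _; rewrite lee_fin expR_ge0.
- apply: (@measurable_fun_integral_finite_kernel _ _ X Y R (fun z : X * Y =>
    (expR (t * ((-1) ^+ b * ((cond_cdf z.1 (V z) < a)%R%:R - a) - eps)))%:E) K).
    by move=> z; rewrite lee_fin expR_ge0.
  apply/measurable_EFinP; apply: (measurableT_comp (@measurable_expR R)).
  apply: measurable_funM => //; apply: measurable_funB => //.
  apply: measurable_funM => //; apply: measurable_funB => //.
  apply: measurable_boolR; apply: measurable_fun_ltr => //.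
  exact: measurable_cond_cdf_V.
- by move=> x _; rewrite lee_fin; nra.
- by apply: filterS ae_D => x Dx _; exact: step.
Qed.

Variables (d : X -> X -> R) (L : R).
Hypothesis md : measurable_fun setT (fun xx : X * X => d xx.1 xx.2).
Hypothesis d0 : forall x y, 0 <= d x y.
Hypothesis L0 : 0 < L.
Hypothesis lipV : forall x x', D x -> D x' -> forall v : R,
  `|cond_cdf x v - cond_cdf x' v| <= L * d x x'.

(** With row data frozen at [(x, v)], the inner integral is at most [1 + w - c] on the ball of
    radius [h] and [1 + w] off it; [q] bounds the mass of the ball from below. *)
Lemma row_mgf_le (x : X) (v eps h q : R) (b : bool) : D x -> 0 < eps <= 1 ->
  0 < h -> h <= eps / (2 * L) -> (q%:E <= PX [set x' | (d x x' <= h)%R])%E ->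
  (\int[PX]_x' \int[K x']_y
     (expR (eps / 32 * (localizer d h x x' *
        ((-1) ^+ b * ((V (x', y) < v)%R%:R - cond_cdf x v) - eps))))%:E
   <= (1 + eps / 16 * expR (- (eps / (2 * L) / h)) - eps ^+ 2 / 128 * expR (- 1) * q)%:E)%E.
Proof.
move=> Dx e01 h0 hd qB; have /andP[e0 e1] := e01.
pose B := [set x' | d x x' <= h].
set w := eps / 16 * _; set c := eps ^+ 2 / 128 * _.
have mdx : measurable_fun setT (d x).
  have mp : measurable_fun setT (fun x' : X => (x, x')) by exact: measurable_pair1.
  exact: (measurableT_comp md mp).
have mB : measurable B by apply: measurable_set_bool; exact: measurable_fun_ler.
have w0 : 0 <= w by rewrite mulr_ge0 ?expR_ge0//; lra.
have c0 : 0 <= c by rewrite mulr_ge0 ?expR_ge0//; nra.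
have c1 : c <= 1.
  have : expR (- 1) <= 1 :> R by rewrite -[leRHS]expR0 ler_expR; lra.
  have := expR_ge0 (- 1 : R); rewrite /c; nra.
have step x' : D x' -> (\int[K x']_y
     (expR (eps / 32 * (localizer d h x x' *
        ((-1) ^+ b * ((V (x', y) < v)%R%:R - cond_cdf x v) - eps))))%:E
   <= (if x' \in B then 1 + w - c else 1 + w)%:E)%E.
  move=> Dx'; pose A := [set y | V (x', y) < v].
  have mA : measurable A.
    apply: measurable_set_bool; apply: measurable_fun_ltr => //.
    exact: measurable_section_V.
  have KA : K x' A = (cond_cdf x' v)%:E.
    exact: (@cdf_of_lt R dY Y (K x') (fun y => V (x', y))
      (prob_kernel x') (measurable_section_V x') (cVc Dx')).
  under eq_integral => y _.
    rewrite (_ : expR _ = if y \in A then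
        expR (eps / 32 * (localizer d h x x' * ((-1) ^+ b * (1 - cond_cdf x v) - eps)))
      else expR (eps / 32 * (localizer d h x x' * ((-1) ^+ b * (0 - cond_cdf x v) - eps)))); last first.
      have -> : (y \in A) = (V (x', y) < v) by apply/idP/idP; rewrite inE.
      by case: (_ < v).
    over.
  rewrite integral_two_values ?expR_ge0//; last exact: prob_kernel.
  rewrite KA lee_fin.
  have kf : `|cond_cdf x' v - cond_cdf x v| <= L * d x x' by rewrite distrC; exact: lipV.
  apply: le_trans (localized_mgf_le b _ _ e01 L0 (d0 x x') h0 hd kf) _.
  - exact: cond_cdf_itv.
  - exact: cond_cdf_itv.
  have -> : (x' \in B) = (d x x' <= h) by apply/idP/idP; rewrite inE.
  by rewrite -/w -/c; case: (_ <= h); rewrite // subr0.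
apply: (@le_trans _ _ (\int[PX]_x' (if x' \in B then 1 + w - c else 1 + w)%:E)%E); last first.
  rewrite integral_two_values//; [|exact: probability_setT|by lra|by lra].
  rewrite lee_fin; have : q <= fine (PX B) by rewrite -lee_fin fineK ?fin_num_measure.
  by nra.
apply: ae_ge0_le_integral => //.
- by move=> x' _; apply: integral_ge0 => y _; rewrite lee_fin expR_ge0.
- apply: (@measurable_fun_integral_finite_kernel _ _ X Y R (fun z : X * Y =>
    (expR (eps / 32 * (localizer d h x z.1 *
        ((-1) ^+ b * ((V z < v)%R%:R - cond_cdf x v) - eps))))%:E) K).
    by move=> z; rewrite lee_fin expR_ge0.
  apply/measurable_EFinP; apply: (measurableT_comp (@measurable_expR R)).
  apply: measurable_funM => //; apply: measurable_funM.
    have mp : measurable_fun setT (fun z : X * Y => (x, z.1)).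
      exact: measurable_fun_pair.
    exact: (measurableT_comp (measurable_localizer md h) mp).
  apply: measurable_funB => //; apply: measurable_funM => //.
  apply: measurable_funB => //; apply: measurable_boolR.
  exact: measurable_fun_ltr.
- by move=> x' _; rewrite lee_fin; case: ifP => _; lra.
- apply/measurable_EFinP; apply: measurable_fun_ifT => //.
  apply: (measurable_fun_bool true); rewrite setTI (_ : _ @^-1` _ = B)//.
  by apply/seteqP; split => x'; rewrite -(in_setE B).
- by apply: filterS ae_D => x' Dx' _; exact: step.
Qed.

(** The bound dominates the integral of an exponential; nonnegativity allows taking powers of it. *)
Lemma row_mgf_bound_ge0 (x : X) (eps h q : R) : D x -> 0 < eps <= 1 ->
  0 < h -> h <= eps / (2 * L) -> (q%:E <= PX [set x' | (d x x' <= h)%R])%E ->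
  0 <= 1 + eps / 16 * expR (- (eps / (2 * L) / h)) - eps ^+ 2 / 128 * expR (- 1) * q.
Proof.
move=> Dx e01 h0 hd qB; rewrite -lee_fin.
apply: le_trans (row_mgf_le 0 false Dx e01 h0 hd qB).
by apply: integral_ge0 => x' _; apply: integral_ge0 => y _; rewrite lee_fin expR_ge0.
Qed.

End ConditionalCdf.

(** * Consequences of the bandwidth rates *)

Section Rates.
Context {R : realType}.
Variables (h : nat -> R) (beta : R).
Hypothesis h_gt0 : forall n, 0 < h n.
Hypothesis h_cvg0 : h @ \oo --> 0.
Hypothesis beta_ge0 : 0 <= beta.

Lemma near_bandwidth_le (e : R) : 0 < e -> \forall n \near \oo, h n <= e.
Proof.
move=> e0; move/cvgrPdist_le : h_cvg0 => /(_ _ e0); apply: filterS => n.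
by rewrite sub0r normrN gtr0_norm.
Qed.

Lemma near_exp_le_powR (delta c : R) : 0 < delta -> 0 < c ->
  \forall n \near \oo, expR (- (delta / h n)) <= c * h n `^ beta.
Proof.
(* [N] is an integer above [beta]. Bounding the exponential by its term of order [N.+1] leaves one
   spare power of [h n], which absorbs the constant [A]. *)
move=> delta0 c0; pose N := (Num.truncn beta).+1.
pose A := N.+1`!%:R / delta ^+ N.+1 : R.
have A0 : 0 < A by rewrite divr_gt0 ?exprn_gt0// ltr0n fact_gt0.
near=> n.
have hn0 := h_gt0 n.
have h1 : h n <= 1 by near: n; exact: near_bandwidth_le.
have h2 : h n <= c / A by near: n; apply: near_bandwidth_le; exact: divr_gt0.
apply: (@le_trans _ _ (c * h n ^+ N)); last first.
  have h01 : 0 < h n <= 1 by rewrite hn0.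
  rewrite ler_pM2l// -powR_mulrn ?(ltW hn0)//.
  by apply: (ger_powR h01); rewrite ltW// truncnS_gt.
have e1 : (delta / h n) ^+ N.+1 / N.+1`!%:R <= expR (delta / h n).
  apply: le_trans (expR_ge1Dxn N _); first by rewrite lerDr.
  by rewrite divr_ge0// ltW.
have e2 : 0 < (delta / h n) ^+ N.+1 / N.+1`!%:R.
  by rewrite divr_gt0 ?exprn_gt0 ?divr_gt0// ltr0n fact_gt0.
rewrite expRN; apply: (@le_trans _ _ ((delta / h n) ^+ N.+1 / N.+1`!%:R)^-1).
  by rewrite lef_pV2 ?posrE ?expR_gt0.
have -> : ((delta / h n) ^+ N.+1 / N.+1`!%:R)^-1 = A * h n ^+ N.+1.
  by rewrite /A invf_div expr_div_n invf_div mulrA mulrAC.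
rewrite exprS mulrA ler_pM2r ?exprn_gt0// mulrC.
by rewrite -ler_pdivlMr.
Unshelve. all: by end_near. Qed.

Hypothesis rate : (fun n : nat => n%:R * h n `^ beta / ln n%:R) @ \oo --> +oo.

(** [C] is quantified after [n] because it depends on the bandwidth. *)
Lemma near_union_bound (c eta : R) : 0 < c -> 0 < eta ->
  \forall n \near \oo, forall C, 0 <= C -> C <= 1 - c * h n `^ beta ->
    n.+1%:R * C ^+ n.-1 <= eta.
Proof.
move=> c0 eta0; near=> n => C C0 C1.
have n2 : (2 <= n)%N by near: n; exact: nbhs_infty_ge.
have nR0 : 0 < n%:R :> R by rewrite ltr0n; apply: leq_trans n2.
have hn0 := h_gt0 n.
have h1 : h n <= 1 by near: n; exact: near_bandwidth_le.
set x := h n `^ beta in C1 *.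
have x0 : 0 <= x by exact: powR_ge0.
have x1 : x <= 1.
  have h01 : 0 < h n <= 1 by rewrite hn0.
  by rewrite /x -[leRHS](powRr0 (h n)); exact: (ger_powR h01).
have ln0 : 0 < ln (n%:R : R) by rewrite ln_gt0// ltr1n.
(* The factor [2 / c] makes the power of order [n ^ -2], enough to beat the [n.+1] rows; passing
   from [n] to [n.-1] factors costs at most [expR c]. *)
have hr : 2 / c * ln n%:R <= n%:R * x.
  rewrite -ler_pdivlMr// /x; near: n.
  by move/cvgryPge : rate => /(_ (2 / c)).
have Ce : C <= expR (- (c * x)) by apply: le_trans C1 (expR_ge1Dx _).
have Cn : C ^+ n.-1 <= expR c * (n%:R ^+ 2)^-1.
  apply: (@le_trans _ _ (expR (- (c * x)) ^+ n.-1)); first by rewrite lerXn2r ?nnegrE ?expR_ge0.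
  rewrite -expRM_natl -[n%:R in leRHS](@lnK R) ?posrE// -expRM_natl -expRN -expRD.
  rewrite ler_expR.
  have -> : n.-1%:R = n%:R - 1 :> R by rewrite -subn1 natrB// ltnW.
  have : c * (2 / c * ln n%:R) <= c * (n%:R * x) by rewrite ler_pM2l.
  rewrite (_ : c * (2 / c * _) = 2 * ln n%:R); last by field; rewrite gt_eqF.
  by nra.
apply: le_trans (ler_wpM2l _ Cn) _ => //.
apply: (@le_trans _ _ (2 * expR c / n%:R)).
  have n1 : n.+1%:R <= 2 * n%:R :> R.
    by rewrite -natrM ler_nat mul2n -addnn -addn1 leq_add2l ltnW.
  rewrite (_ : 2 * expR c / n%:R = 2 * n%:R * (expR c * (n%:R ^+ 2)^-1)); last first.
    by field; rewrite gt_eqF.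
  by apply: ler_wpM2r => //; rewrite mulr_ge0 ?expR_ge0// invr_ge0 exprn_ge0.
rewrite ler_pdivrMr// -ler_pdivrMl//.
near: n; exact: nbhs_infty_ger.
Unshelve. all: by end_near. Qed.

Lemma near_geometric_le (rho eta : R) : 0 <= rho < 1 -> 0 < eta ->
  \forall n \near \oo, rho ^+ n <= eta.
Proof.
move=> /andP[r0 r1] eta0.
have : rho ^+ n @[n --> \oo] --> 0 by apply: cvg_expr; rewrite ger0_norm.
move/cvgrPdist_le => /(_ _ eta0); apply: filterS => n.
by rewrite sub0r normrN ger0_norm ?exprn_ge0.
Qed.

End Rates.

(** * The bad event and its probability *)

Lemma measure_bigsetU_le (R : realType) (dO : measure_display) (Om : measurableType dO)
    (mu : {measure set Om -> \bar R}) (I : Type) (s : seq I) (A : I -> set Om) (c : R) :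
  (forall i, measurable (A i)) -> (forall i, mu (A i) <= c%:E)%E ->
  (mu (\big[setU/set0]_(i <- s) A i) <= ((size s)%:R * c)%:E)%E.
Proof.
move=> mA Ac; elim: s => [|i s IH]; first by rewrite big_nil measure0 mul0r.
rewrite big_cons /=; apply: le_trans (measureU2 _ _ _) _ => //.
  exact: bigsetU_measurable.
by rewrite -natr1 mulrDl mul1r EFinD addeC; exact: leeD (Ac i) IH.
Qed.

Section GoodEvent.
Context (R : realType) (dX dY dO : measure_display).
Context (X : measurableType dX) (Y : measurableType dY) (Om : measurableType dO).
Context (PX : probability X R) (K : R.-pker X ~> Y) (P : probability Om R).
Variables (V : X * Y -> R) (d : X -> X -> R) (D : set X) (L : R).
Hypothesis mV : measurable_fun setT V.
Hypothesis md : measurable_fun setT (fun xx : X * X => d xx.1 xx.2).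
Hypothesis d0 : forall x y, 0 <= d x y.
Hypothesis L0 : 0 < L.
Hypothesis mD : measurable D.
Hypothesis PXD : PX D = 1%E.
Hypothesis cV : forall x, D x -> continuous (cond_cdf K V x).
Hypothesis lipV : forall x x', D x -> D x' -> forall v : R,
  `|cond_cdf K V x v - cond_cdf K V x' v| <= L * d x x'.
Variables (Zs : nat -> Om -> X * Y) (W : Om -> Y) (x0 : X).
Hypothesis Dx0 : D x0.
Hypothesis mZs : forall i, measurable_fun setT (Zs i).
Hypothesis mW : measurable_fun setT W.
Hypothesis Zlaw : forall i (A : set X) (B : set Y), measurable A -> measurable B ->
  P (Zs i @^-1` (A `*` B)) = (\int[PX]_(x in A) K x B)%E.
Hypothesis indepZW : forall (s : seq nat) (A : nat -> set (X * Y)) (B : set Y),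
  uniq s -> (forall i, measurable (A i)) -> measurable B ->
  fine (P (W @^-1` B `&` \big[setI/setT]_(i <- s) (Zs i @^-1` A i)))
    = fine (P (W @^-1` B)) * \prod_(i <- s) fine (P (Zs i @^-1` A i)).

Variables (n : nat) (h eps q : R).
Hypothesis h0 : 0 < h.
Hypothesis e01 : 0 < eps <= 1.
Hypothesis heps : h <= eps / (2 * L).
Hypothesis qle : forall x, D x -> (q%:E <= PX [set x' | (d x x' <= h)%R])%E.

Let C := 1 + eps / 16 * expR (- (eps / (2 * L) / h)) - eps ^+ 2 / 128 * expR (- 1) * q.
Hypothesis C1 : C <= 1.

Let C_ge0 : 0 <= C.
Proof.
exact: (row_mgf_bound_ge0 mV mD PXD cV md d0 L0 lipV Dx0 e01 h0 heps (qle Dx0)).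
Qed.

Let sX om := sampleX n Zs x0 om.
Let sV om := sampleV V n Zs x0 W om.
Let zeta (i : 'I_n.+1) om := if (i < n)%N then Zs i om else (x0, W om).
Let U om i := cond_cdf K V (sX om i) (sV om i).

Let sXE om i : sX om i = (zeta i om).1.
Proof. by rewrite /sX /sampleX /zeta; case: ifP. Qed.

Let sVE om i : sV om i = V (zeta i om).
Proof. by rewrite /sV /sampleV /zeta; case: ifP. Qed.

Let lt_max (j : 'I_n.+1) : j != ord_max -> (j < n)%N.
Proof.
move=> jm; rewrite ltn_neqAle -ltnS ltn_ord andbT.
by apply: contraNneq jm => jn; apply/eqP/val_inj.
Qed.

Let mzeta i : measurable_fun setT (zeta i).
Proof.
rewrite /zeta; case: (i < n)%N; first exact: mZs.
by apply: measurable_fun_pair => //; exact: measurable_cst.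
Qed.

(** This licenses freezing row [i] while [Zs k] is integrated out, and is why [j = i] is left out of
    the row sum. *)
Let mzeta_without (i : 'I_n.+1) (k : nat) : k != i :> nat -> (k < n)%N ->
  measurable_fun setT (zeta i : g_sigma_algebraType (cylinders_without Zs W k) -> X * Y).
Proof.
move=> ki kn; rewrite /zeta; case: (i < n)%N.
  by apply: measurable_Zs_without; rewrite eq_sym.
by apply: measurable_fun_pair; [exact: measurable_cst|exact: measurable_W_without].
Qed.

(** The condition on [D] makes the moment bound available at every frozen covariate; covariates
    outside [D] form separate null events. *)
Definition row_bad (ib : 'I_n.+1 * bool) := [set om | D (sX om ib.1) /\
  - 2 <= \sum_(j < n.+1 | (j != ib.1) && (j != ord_max))
     localizer d h (sX om ib.1) (sX om j) *
       ((-1) ^+ ib.2 * ((sV om j < sV om ib.1)%R%:R - U om ib.1) - eps)].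

Let tilt b (z z' : X * Y) : R := eps / 32 * (localizer d h z.1 z'.1 *
  ((-1) ^+ b * ((V z' < V z)%R%:R - cond_cdf K V z.1 (V z)) - eps)).

Let row_seq (i : 'I_n.+1) : seq nat :=
  [seq val j | j <- index_enum 'I_n.+1 & (j != i) && (j != ord_max)].

Let eps32 : 0 < eps / 32.
Proof. by case/andP: e01 => e0 _; rewrite divr_gt0. Qed.

Let row_badE i b : row_bad (i, b) = [set om | (fst @^-1` D) (zeta i om) /\
  - 2 * (eps / 32) <= \sum_(k <- row_seq i) tilt b (zeta i om) (Zs k om)].
Proof.
have E om : \sum_(k <- row_seq i) tilt b (zeta i om) (Zs k om) = eps / 32 *
    \sum_(j < n.+1 | (j != i) && (j != ord_max)) localizer d h (sX om i) (sX om j) *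
       ((-1) ^+ b * ((sV om j < sV om i)%R%:R - U om i) - eps).
  rewrite /row_seq big_map big_filter mulr_sumr; apply: eq_bigr => j /andP[_ jm].
  by rewrite /U !sXE !sVE /tilt /zeta (lt_max jm).
apply/seteqP; split => om; rewrite /row_bad /= E sXE => -[Dz hs]; split => //; move: hs.
  by rewrite (mulrC (eps / 32)) ler_pM2r.
by rewrite (mulrC (eps / 32)) ler_pM2r.
Qed.

Let mtilt b : measurable_fun setT (fun qq : (X * Y) * (X * Y) => tilt b qq.1 qq.2).
Proof.
apply: measurable_funM => //; apply: measurable_funM.
  have mp : measurable_fun setT (fun qq : (X * Y) * (X * Y) => (qq.1.1, qq.2.1)).
    by apply: measurable_fun_pair; exact: measurableT_comp.
  exact: (measurableT_comp (measurable_localizer md h) mp).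
apply: measurable_funB => //; apply: measurable_funM => //.
apply: measurable_funB; last exact: (measurableT_comp (measurable_cond_cdf_V _ mV)).
by apply: measurable_boolR; apply: measurable_fun_ltr; exact: measurableT_comp.
Qed.

Let measurable_row_bad ib : measurable (row_bad ib).
Proof.
case: ib => i b; rewrite row_badE; apply: measurableI.
  rewrite -[X in measurable X]setTI; apply: mzeta => //.
  by rewrite -[X in measurable X]setTI; exact: measurable_fst.
apply: measurable_set_bool; apply: measurable_fun_ler => //.
apply: measurable_sum => k.
have mp : measurable_fun setT (fun om => (zeta i om, Zs k om)).
  exact: measurable_fun_pair.
exact: (measurableT_comp (mtilt b) mp).
Qed.

Let P_row_bad ib : (P (row_bad ib) <= (expR (eps / 16) * C ^+ n.-1)%:E)%E.
Proof.
case: ib => i b; rewrite row_badE.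
have us : uniq (row_seq i).
  by rewrite map_inj_uniq ?filter_uniq ?index_enum_uniq//; exact: val_inj.
have row_seqP k : k \in row_seq i -> (k != i :> nat) && (k < n)%N.
  move=> /mapP[j]; rewrite mem_filter => /andP[/andP[ji jm] _] ->.
  by rewrite ji lt_max.
(* A row has [n.-1] terms, or [n] for the test row; since [C <= 1], the exponent [n.-1] serves
   both. *)
have ss : (n.-1 <= size (row_seq i))%N.
  rewrite size_map size_filter -sum1_count sum1_card.
  have := cardC (pred2 i ord_max); rewrite card2 card_ord => /eqP.
  rewrite (eq_card (_ : [predC pred2 i ord_max] =i
    [pred j | (j != i) && (j != ord_max)])); last by move=> j; rewrite !inE negb_or.
  have pred_le (c : bool) x m : (c + x = m)%N -> (m.-1 <= x)%N.
    by case: c => <-; rewrite ?add1n ?add0n ?leq_pred.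
  by rewrite addSn eqSS => /eqP; exact: pred_le.
apply: le_trans (@chernoff_bound _ _ _ Om R P _ Y Zs W mZs mW indepZW _ _ (zeta i) (fst @^-1` D)
  (fun qq => tilt b qq.1 qq.2) C (- 2 * (eps / 32)) (row_seq i) _ _ _ _ _ _ _) _ => //.
- by rewrite -[X in measurable X]setTI; exact: measurable_fst.
- by move=> k /row_seqP/andP[ki kn]; exact: mzeta_without.
- move=> k z _ Dz.
  rewrite (@integral_joint_law _ _ X Y R PX K _ Om P (Zs k) (mZs k) (Zlaw k)
     (fun z' => (expR (tilt b z z'))%:E)).
  + exact: (row_mgf_le mV mD PXD cV md d0 L0 lipV _ b Dz e01 h0 heps (qle Dz)).
  + apply/measurable_EFinP; apply: (measurableT_comp (@measurable_expR R)).
    exact: (measurable_fun_pair2 _ (mtilt b)).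
  + by move=> z'; rewrite lee_fin expR_ge0.
rewrite lee_fin mulNr opprK; apply: ler_pM; rewrite ?expR_ge0 ?exprn_ge0//.
  by rewrite ler_expR; lra.
exact: ler_wiXn2l.
Qed.

Let null_bad (i : 'I_n.+1) : P [set om | ~ D (sX om i)] = 0%E.
Proof.
rewrite /sX /sampleX; case: (i < n)%N; last first.
  by rewrite (_ : [set om | _] = set0) ?measure0//; apply/seteqP; split => om //=.
rewrite (_ : [set om | _] = Zs i @^-1` ((~` D) `*` setT)); last first.
  by apply/seteqP; split => om //= [].
rewrite Zlaw//; last exact: measurableC.
under eq_integral do rewrite prob_kernel.
have PD0 : PX (~` D) = 0%E by rewrite probability_setC ?PXD ?subee.
rewrite integral_cst; last exact: measurableC.
by rewrite [X in (_ * X)%E]PD0 mule0.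
Qed.

Let measurable_notD (i : 'I_n.+1) : measurable [set om | ~ D (sX om i)].
Proof.
rewrite (_ : [set om | _] = setT `&` (fst \o zeta i) @^-1` (~` D)).
  have mfz : measurable_fun setT (fst \o zeta i) by exact: measurableT_comp.
  by apply: mfz => //; exact: measurableC.
by rewrite setTI; apply/seteqP; split => om /=; rewrite sXE.
Qed.

Definition lln_bad (a : R) (b : bool) := [set om | - 2 <=
  \sum_(i < n.+1 | i != ord_max) ((-1) ^+ b * ((U om i < a)%R%:R - a) - eps)].

Let lln_seq : seq nat := [seq val j | j <- index_enum 'I_n.+1 & j != ord_max].

Let lln_tilt a b (z' : X * Y) : R :=
  eps / 32 * ((-1) ^+ b * ((cond_cdf K V z'.1 (V z') < a)%R%:R - a) - eps).

Let lln_badE a b : lln_bad a b = [set om | setT tt /\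
  - 2 * (eps / 32) <= \sum_(k <- lln_seq) lln_tilt a b (Zs k om)].
Proof.
have E om : \sum_(k <- lln_seq) lln_tilt a b (Zs k om) = eps / 32 *
    \sum_(i < n.+1 | i != ord_max) ((-1) ^+ b * ((U om i < a)%R%:R - a) - eps).
  rewrite /lln_seq big_map big_filter mulr_sumr; apply: eq_bigr => j jm.
  by rewrite /U sXE sVE /lln_tilt /zeta (lt_max jm).
apply/seteqP; split => om; rewrite /lln_bad /= E (mulrC (eps / 32)) ler_pM2r//.
by case.
Qed.

Let mlln_tilt a b : measurable_fun setT (lln_tilt a b).
Proof.
apply: measurable_funM => //; apply: measurable_funB => //; apply: measurable_funM => //.
apply: measurable_funB => //; apply: measurable_boolR; apply: measurable_fun_ltr => //.
exact: measurable_cond_cdf_V.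
Qed.

Let measurable_lln_bad a b : measurable (lln_bad a b).
Proof.
rewrite lln_badE (_ : [set om | _ /\ _] = [set om | - 2 * (eps / 32) <=
    \sum_(k <- lln_seq) lln_tilt a b (Zs k om)]); last first.
  by apply/seteqP; split => om //= [].
apply: measurable_set_bool; apply: measurable_fun_ler => //.
by apply: measurable_sum => k; exact: (measurableT_comp (mlln_tilt a b)).
Qed.

Let P_lln_bad a b : 0 < a < 1 ->
  (P (lln_bad a b) <= (expR (eps / 16) * (1 - eps ^+ 2 / 64) ^+ n)%:E)%E.
Proof.
move=> a01; rewrite lln_badE; have /andP[e0 e1] := e01.
have us : uniq lln_seq.
  by rewrite map_inj_uniq ?filter_uniq ?index_enum_uniq//; exact: val_inj.
have ss : size lln_seq = n.
  rewrite size_map -sum1_size big_filter sum1_card cardC1 card_ord//.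
(* The terms involve one observation each, so nothing is frozen and [zeta] is trivial. *)
apply: le_trans (@chernoff_bound _ _ _ Om R P _ Y Zs W mZs mW indepZW _ unit (fun=> tt) setT
  (fun qq => lln_tilt a b qq.2) (1 - eps ^+ 2 / 64) (- 2 * (eps / 32)) lln_seq _ _ _ _ _ _ _) _ => //.
- exact: measurableT_comp.
- by nra.
- move=> k z _ _.
  rewrite (@integral_joint_law _ _ X Y R PX K _ Om P (Zs k) (mZs k) (Zlaw k)
     (fun z' => (expR (lln_tilt a b z'))%:E)).
  + exact: (lln_mgf_le mV mD PXD cV b a01 e01).
  + apply/measurable_EFinP; exact: (measurableT_comp (@measurable_expR R) (mlln_tilt a b)).
  + by move=> z'; rewrite lee_fin expR_ge0.
rewrite ss lee_fin mulNr opprK ler_pM2r; last by rewrite exprn_gt0//; nra.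
by rewrite ler_expR; lra.
Qed.

(** [Bad] unites the row events for both signs, the null events and two counting events; off it the
    deterministic estimates apply to each [om] separately. *)
Lemma good_event (alpha : R) : 0 < alpha - 2 * eps -> alpha + 4 * eps <= 1 ->
  exists Bad : set Om, [/\ measurable Bad,
    (P Bad <= (2 * expR (eps / 16) * (n.+1%:R * C ^+ n.-1)
               + 2 * expR (eps / 16) * (1 - eps ^+ 2 / 64) ^+ n)%:E)%E &
    forall om, ~ Bad om ->
      (forall v, `|alpha_tilde d h (sX om) (sV om) alpha v - alpha| <= 4 * eps) /\
      `|local_rank d h (sX om) (sV om) ord_max - U om ord_max| < eps].
Proof.
move=> ae1 ae2; have /andP[e0 e1] := e01.
pose Brow := \big[setU/set0]_(ib <- index_enum _) row_bad ib.
pose BD := \big[setU/set0]_(i <- index_enum _) [set om | ~ D (sX om i)].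
pose a b := alpha + (-1) ^+ (~~ b) * (2 * eps).
have a01 b : 0 < a b < 1.
  by rewrite /a; case: b; rewrite /= ?expr1 ?expr0; apply/andP; split; lra.
pose Blln := lln_bad (a false) false `|` lln_bad (a true) true.
have mBrow : measurable Brow by exact: bigsetU_measurable.
have mBD : measurable BD by exact: bigsetU_measurable.
have mBlln : measurable Blln by exact: measurableU.
exists (Brow `|` BD `|` Blln); split.
- by apply: measurableU => //; exact: measurableU.
- apply: le_trans (measureU2 _ _ _) _ => //; first exact: measurableU.
  rewrite EFinD; apply: leeD; last first.
    apply: le_trans (measureU2 _ _ _) _ => //.
    rewrite -mulrA mulrDl mul1r EFinD.
    by apply: leeD; exact: P_lln_bad.
  apply: le_trans (measureU2 _ _ _) _ => //; rewrite -[leRHS]adde0; apply: leeD.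
    apply: le_trans (measure_bigsetU_le _ measurable_row_bad P_row_bad) _.
    rewrite lee_fin -sum1_size sum1_card card_prod card_ord card_bool natrM.
    by rewrite le_eqVlt; apply/orP; left; apply/eqP; ring.
  apply: (@le_trans _ _ ((size (index_enum 'I_n.+1))%:R * 0)%:E); last by rewrite mulr0.
  by apply: measure_bigsetU_le => i; [exact: measurable_notD|rewrite [leLHS]null_bad].
move=> om /not_orP[/not_orP[nrow nD] nlln].
have U01 i : 0 <= U om i <= 1 by exact: cond_cdf_itv.
have Di i : D (sX om i).
  apply: contrapT => nDi; apply: nD; rewrite /BD -bigcup_seq; exists i => //=.
  by rewrite mem_index_enum.
have rows i (b : bool) : \sum_(j < n.+1 | (j != i) && (j != ord_max))
   localizer d h (sX om i) (sX om j) *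
    ((-1) ^+ b * ((sV om j < sV om i)%R%:R - U om i) - eps) < - 2.
  rewrite ltNge; apply/negP => hrow; apply: nrow.
  by rewrite /Brow -bigcup_seq; exists (i, b) => //=; rewrite mem_index_enum.
have llns (b : bool) : \sum_(i < n.+1 | i != ord_max)
    ((-1) ^+ b * ((U om i < a b)%R%:R - a b) - eps) < - 2.
  rewrite ltNge; apply/negP => hl; apply: nlln.
  by case: b hl => hl; [right|left].
split => [v|]; last exact: (true_rank_close h0 d0 U01 e0 rows).
apply: (alpha_tilde_close h0 d0 _ U01 e0 rows ae2 llns).
by apply/andP; split; lra.
Qed.

End GoodEvent.

(** * Passage to the limit *)

Section ConformalLimits.
Context (R : realType) (dX dY dO : measure_display).
Context (X : measurableType dX) (Y : measurableType dY) (Om : measurableType dO).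
Context (PX : probability X R) (K : R.-pker X ~> Y) (P : probability Om R).
Variables (V : X * Y -> R) (d : X -> X -> R) (D : set X) (L beta alpha : R).
Variable h : nat -> R.
Hypothesis mV : measurable_fun setT V.
Hypothesis md : measurable_fun setT (fun xx : X * X => d xx.1 xx.2).
Hypothesis d0 : forall x y, 0 <= d x y.
Hypothesis L0 : 0 < L.
Hypothesis beta0 : 0 <= beta.
Hypothesis alpha01 : 0 < alpha < 1.
Hypothesis mD : measurable D.
Hypothesis PXD : PX D = 1%E.
Hypothesis cV : forall x, D x -> continuous (cond_cdf K V x).
Hypothesis lipV : forall x x', D x -> D x' -> forall v : R,
  `|cond_cdf K V x v - cond_cdf K V x' v| <= L * d x x'.
Hypothesis h_gt0 : forall n, 0 < h n.
Hypothesis h_cvg0 : h @ \oo --> 0.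
Hypothesis rate : (fun n : nat => n%:R * h n `^ beta / ln n%:R) @ \oo --> +oo.
Hypothesis small_ball : forall n x, D x ->
  ((h n `^ beta / L)%:E <= PX [set x' | (d x x' <= h n)%R])%E.
Variables (Zs : nat -> Om -> X * Y) (W : Om -> Y) (x0 : X).
Hypothesis Dx0 : D x0.
Hypothesis mZs : forall i, measurable_fun setT (Zs i).
Hypothesis mW : measurable_fun setT W.
Hypothesis Zlaw : forall i (A : set X) (B : set Y), measurable A -> measurable B ->
  P (Zs i @^-1` (A `*` B)) = (\int[PX]_(x in A) K x B)%E.
Hypothesis Wlaw : forall B : set Y, measurable B -> P (W @^-1` B) = K x0 B.
Hypothesis indepZW : forall (s : seq nat) (A : nat -> set (X * Y)) (B : set Y),
  uniq s -> (forall i, measurable (A i)) -> measurable B ->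
  fine (P (W @^-1` B `&` \big[setI/setT]_(i <- s) (Zs i @^-1` A i)))
    = fine (P (W @^-1` B)) * \prod_(i <- s) fine (P (Zs i @^-1` A i)).

Local Notation sX n om := (sampleX n Zs x0 om).
Local Notation sV n om := (sampleV V n Zs x0 W om).
Let u0 om := cond_cdf K V x0 (V (x0, W om)).

Definition good_sample n (eps : R) om :=
  (forall v, `|alpha_tilde d (h n) (sX n om) (sV n om) alpha v - alpha| <= 4 * eps) /\
  `|local_rank d (h n) (sX n om) (sV n om) ord_max - u0 om| < eps.

Lemma near_good_sample (eps eta : R) : 0 < eps <= 1 -> 0 < alpha - 2 * eps ->
  alpha + 4 * eps <= 1 -> 0 < eta ->
  \forall n \near \oo, exists Bad : set Om, [/\ measurable Bad, (P Bad <= eta%:E)%E &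
    forall om, ~ Bad om -> good_sample n eps om].
Proof.
move=> e01 ae1 ae2 eta0; have /andP[e0 e1] := e01.
(* Half of the available drift: the other half absorbs the contribution of distant points. *)
pose c := eps ^+ 2 / 256 * expR (- 1) / L.
have c0 : 0 < c by rewrite divr_gt0// mulr_gt0 ?expR_gt0// divr_gt0// exprn_gt0.
have del0 : 0 < eps / (2 * L) by rewrite divr_gt0// mulr_gt0.
(* Chosen so that each of the two summands in the bound of [good_event] is at most half of [eta]. *)
pose eta' := eta / (4 * expR (eps / 16)).
have E0 : 0 < expR (eps / 16) by exact: expR_gt0.
have eta'0 : 0 < eta' by rewrite divr_gt0// mulr_gt0.
have rho01 : 0 <= 1 - eps ^+ 2 / 64 < 1 by apply/andP; split; nra.
near=> n.
have hd : h n <= eps / (2 * L) by near: n; exact: near_bandwidth_le.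
have he : expR (- (eps / (2 * L) / h n)) <= c / (eps / 16) * h n `^ beta.
  by near: n; apply: near_exp_le_powR => //; rewrite divr_gt0// divr_gt0.
have hu : forall C, 0 <= C -> C <= 1 - c * h n `^ beta -> n.+1%:R * C ^+ n.-1 <= eta'.
  by near: n; exact: near_union_bound.
have hg : (1 - eps ^+ 2 / 64) ^+ n <= eta' by near: n; exact: near_geometric_le.
pose C := 1 + eps / 16 * expR (- (eps / (2 * L) / h n))
            - eps ^+ 2 / 128 * expR (- 1) * (h n `^ beta / L).
have Cle : C <= 1 - c * h n `^ beta.
  have : eps / 16 * expR (- (eps / (2 * L) / h n)) <= c * h n `^ beta.
    rewrite -ler_pdivlMl; last by rewrite divr_gt0.
    by apply: le_trans he _; rewrite mulrA (mulrC c).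
  have -> : C = 1 + eps / 16 * expR (- (eps / (2 * L) / h n)) - 2 * (c * h n `^ beta).
    by rewrite /C /c; field; rewrite gt_eqF.
  by lra.
have hb0 : 0 <= c * h n `^ beta by rewrite mulr_ge0 ?powR_ge0// ltW.
have C1 : C <= 1 by lra.
have C0 : 0 <= C.
  exact: (row_mgf_bound_ge0 mV mD PXD cV md d0 L0 lipV Dx0 e01 (h_gt0 n) hd (small_ball n Dx0)).
have [Bad [mBad PBad good]] := good_event mV md d0 L0 mD PXD cV lipV Dx0 mZs mW Zlaw indepZW
  n (h_gt0 n) e01 hd (small_ball n) C1 ae1 ae2.
exists Bad; split => //.
  apply: le_trans PBad _; rewrite lee_fin.
  have h1 := hu C C0 Cle.
  have -> : eta = 2 * expR (eps / 16) * eta' + 2 * expR (eps / 16) * eta'.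
    by rewrite /eta'; field; rewrite gt_eqF.
  by apply: lerD; rewrite ler_pM2l// mulr_gt0.
move=> om /good[ha hr]; split => //.
by move: hr; rewrite /u0 /sampleX /sampleV ltnn.
Unshelve. all: by end_near. Qed.

Let P_u0 a : 0 < a < 1 -> P [set om | u0 om < a] = a%:E.
Proof.
move=> a01.
have mF : measurable_fun setT (fun y => cond_cdf K V x0 (V (x0, y))).
  have mp : measurable_fun setT (fun y => (x0, V (x0, y))).
    by apply: measurable_fun_pair => //; exact: measurable_section_V.
  exact: (measurableT_comp (measurable_cond_cdf K mV) mp).
rewrite -[LHS]/(P (W @^-1` [set y | cond_cdf K V x0 (V (x0, y)) < a])) Wlaw.
  exact: (@probability_integral_transform R dY Y (K x0) (fun y => V (x0, y))
      (prob_kernel x0) (measurable_section_V mV x0) (cV Dx0)).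
by apply: measurable_set_bool; exact: measurable_fun_ltr.
Qed.

Let mu0 a : measurable [set om | u0 om < a].
Proof.
have mp : measurable_fun setT (fun om => (x0, V (x0, W om))).
  apply: measurable_fun_pair => //.
  exact: (measurableT_comp (measurable_section_V mV x0) mW).
apply: measurable_set_bool; apply: measurable_fun_ltr => //.
exact: (measurableT_comp (measurable_cond_cdf K mV) mp).
Qed.

Let fin_cvg (E : nat -> set Om) (l : R) : (forall n, measurable (E n)) ->
  (forall e, 0 < e -> \forall n \near \oo, `|l - fine (P (E n))| <= e) ->
  (fun n => P (E n)) @ \oo --> l%:E.
Proof.
move=> mE hE; rewrite (_ : (fun n => P (E n)) = EFin \o (fun n => fine (P (E n)))).
  by apply: cvg_EFin; [exact: nearW|apply/cvgrPdist_le].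
by apply/funext => n /=; rewrite fineK ?fin_num_measure.
Qed.

(** The 5 collects [4 * eps] from [alpha_tilde] and [eps] from the rank. *)
Let small_eps (e : R) : 0 < e -> exists eps, [/\ 0 < eps <= 1, 0 < alpha - 5 * eps,
  alpha + 5 * eps < 1 & 12 * eps <= e].
Proof.
move=> e0; have /andP[a0 a1] := alpha01.
pose m := Num.min e (Num.min alpha (1 - alpha)).
have m0 : 0 < m by rewrite /m !lt_min e0 a0 subr_gt0 a1.
have me : m <= e by rewrite /m ge_min lexx.
have ma : m <= alpha by rewrite /m !ge_min lexx orbT.
have m1 : m <= 1 - alpha by rewrite /m !ge_min lexx !orbT.
by exists (m / 12); split; [apply/andP; split| | |]; lra.
Qed.

(** Off the bad event, [E n] lies between two sublevel events of [u0], whose probabilities are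
    exactly [alpha - 5 * eps] and [alpha + 5 * eps] by uniformity. *)
Lemma sandwiched_event_cvg (E : nat -> set Om) : (forall n, measurable (E n)) ->
  (forall n eps om, good_sample n eps om ->
     (u0 om < alpha - 5 * eps -> E n om) /\ (E n om -> u0 om < alpha + 5 * eps)) ->
  (fun n => P (E n)) @ \oo --> alpha%:E.
Proof.
move=> mE hE; apply: fin_cvg => // e e0.
have [eps [e01 ae1 ae2 ee]] := small_eps e0; have /andP[eps0 _] := e01.
have e20 : 0 < e / 2 by rewrite divr_gt0.
have : \forall n \near \oo, exists Bad : set Om, [/\ measurable Bad,
    (P Bad <= (e / 2)%:E)%E & forall om, ~ Bad om -> good_sample n eps om].
  by apply: near_good_sample => //; lra.
apply: filterS => n [Bad [mBad PBad good]].
have PE : P (E n) = (fine (P (E n)))%:E by rewrite fineK ?fin_num_measure.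
have lo : alpha - 5 * eps <= fine (P (E n)) + e / 2.
  rewrite -lee_fin [leRHS]EFinD -PE -[(alpha - 5 * eps)%:E]P_u0; last by rewrite ae1; lra.
  apply: (@le_trans _ _ (P (E n) + P Bad)%E); last exact: leeD.
  apply: le_trans (measureU2 _ _ _) => //; apply: le_measure; rewrite ?inE//.
    exact: measurableU.
  move=> om /= hu; have [?|nB] := pselect (Bad om); [by right|left].
  by have [h1 _] := hE _ _ _ (good _ nB); exact: h1.
have hi : fine (P (E n)) <= alpha + 5 * eps + e / 2.
  rewrite -lee_fin [leRHS]EFinD -PE -[(alpha + 5 * eps)%:E]P_u0; last by rewrite ae2 andbT; lra.
  apply: (@le_trans _ _ (P [set om | (u0 om < alpha + 5 * eps)%R] + P Bad)%E); last exact: leeD.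
  apply: le_trans (measureU2 _ _ _) => //; apply: le_measure; rewrite ?inE//.
    exact: measurableU.
  move=> om /= Eom; have [?|nB] := pselect (Bad om); [by right|left].
  by have [_ h2] := hE _ _ _ (good _ nB); exact: h2.
by rewrite ler_norml; apply/andP; split; lra.
Qed.

Let mX n i : measurable_fun setT (fun om => sX n om i).
Proof.
rewrite /sampleX; case: (i < n)%N; last exact: measurable_cst.
exact: measurableT_comp.
Qed.

Let mVs n i : measurable_fun setT (fun om => sV n om i).
Proof.
rewrite /sampleV; case: (i < n)%N; first exact: measurableT_comp.
exact: (measurableT_comp (measurable_section_V mV x0) mW).
Qed.

Lemma conf_set_coverage_cvg :
  (fun n => P [set om | conf_set d (h n) (sX n om) (sV n om) alpha (sV n om ord_max)])
    @ \oo --> alpha%:E.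
Proof.
apply: sandwiched_event_cvg => [n|n eps om [ha hr]].
  exact: (measurable_conf_set_event (h n) md alpha01 (@mX n) (@mVs n)).
(* Uniformity in [v] matters here: it is applied at the random test score. *)
move: hr (ha (sV n om ord_max)); rewrite /= /conf_set /= le_Fhat_quantile.
rewrite ltr_norml ler_norml => /andP[h1 h2] /andP[h3 h4].
by split; lra.
Qed.

Lemma Fhat_coverage_cvg :
  (fun n => P [set om | ((sV n om ord_max)%:E <=
       Fhat_quantile d (h n) (sX n om) (sV n om) alpha)%E]) @ \oo --> alpha%:E.
Proof.
apply: sandwiched_event_cvg => [n|n eps om [ha hr]].
  exact: (measurable_Fhat_event (h n) md (@mX n) (@mVs n)).
have e0 := le_lt_trans (normr_ge0 _) hr.
move: hr; rewrite /= le_Fhat_quantile ltr_norml => /andP[h1 h2].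
by split; lra.
Qed.

Lemma alpha_tilde_uniform_cvg (e : R) : 0 < e ->
  (fun n => P [set om | sup (range (fun v : R =>
     `|alpha_tilde d (h n) (sX n om) (sV n om) alpha v - alpha|)) < e]) @ \oo --> 1%E.
Proof.
move=> e0.
have mE n := measurable_sup_event (h n) md alpha01 (@mX n) (@mVs n) e.
apply: fin_cvg => // eta eta0.
have [eps [e01 ae1 ae2 ee]] := small_eps e0; have /andP[eps0 _] := e01.
have : \forall n \near \oo, exists Bad : set Om, [/\ measurable Bad,
    (P Bad <= eta%:E)%E & forall om, ~ Bad om -> good_sample n eps om].
  by apply: near_good_sample => //; lra.
apply: filterS => n [Bad [mBad PBad good]].
set E := [set om | _].
have PE : P E = (fine (P E))%:E by rewrite fineK ?fin_num_measure//; exact: mE.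
have lo : 1 <= fine (P E) + eta.
  rewrite -lee_fin [leRHS]EFinD -PE -(probability_setT P).
  apply: (@le_trans _ _ (P E + P Bad)%E); last exact: leeD.
  apply: le_trans (measureU2 _ _ _) => //; last exact: mE.
  apply: le_measure; rewrite ?inE//; first by apply: measurableU => //; exact: mE.
  move=> om _; have [?|nB] := pselect (Bad om); [by right|left].
  have [ha _] := good _ nB; rewrite /E /=.
  apply: (@le_lt_trans _ _ (4 * eps)); last by lra.
  apply: ge_sup; last by move=> _ [v _ <-]; exact: ha.
  by exists `|alpha_tilde d (h n) (sX n om) (sV n om) alpha 0 - alpha|, 0.
have hi : fine (P E) <= 1 by rewrite -lee_fin -PE probability_le1//; exact: mE.
by rewrite ler_norml; apply/andP; split; lra.
Qed.

End ConformalLimits.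

Lemma measurable_unit_cube (R : realType) (p : nat) : measurable (unit_cube R p).
Proof.
rewrite (_ : unit_cube R p = \bigcap_(i in [set: 'I_p])
   (fun x : p.-tuple R => tnth x i) @^-1` `[0, 1]); last first.
  apply/seteqP; split => x /= hx i; first by move=> _; rewrite /= in_itv; exact: hx.
  by have := hx i I; rewrite /= in_itv.
apply: fin_bigcap_measurable => [|i _]; first exact: finite_finset.
by rewrite -[X in measurable X]setTI; exact: measurable_tnth.
Qed.

(** Conditioning on [X_{n+1} = x0] is encoded by a test pair [(x0, W)] with [W] of law [K x0],
    independent of the calibration sample. *)
Theorem theorem3
  (R : realType) (p : nat) (dY : measure_display) (Y : measurableType dY)
  (PX : probability (p.-tuple R) R) (K : R.-pker (p.-tuple R) ~> Y)
  (V : (p.-tuple R * Y)%type -> R) (d : p.-tuple R -> p.-tuple R -> R)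
  (h : nat -> R) (L beta alpha : R)
  (hV : measurable_fun setT V)
  (hdm : measurable_fun setT (fun xx : (p.-tuple R * p.-tuple R)%type => d xx.1 xx.2))
  (hd0 : forall x y, 0 <= d x y) (hdxx : forall x, d x x = 0)
  (hh : forall n, 0 < h n)
  (hL : 0 < L) (hbeta : 0 <= beta)
  (hPXcube : PX (unit_cube R p) = 1%E)
  (hdens : exists (lam : {measure set (p.-tuple R) -> \bar R}) (f : p.-tuple R -> R),
      [/\ (forall a b : p.-tuple R, (forall i, tnth a i <= tnth b i) ->
             lam (box a b) = (\prod_(i < p) (tnth b i - tnth a i))%:E),
          measurable_fun setT f, (forall x, 0 <= f x),
          (forall A, measurable A -> PX A = (\int[lam]_(x in A) (f x)%:E)%E) &
          (forall x, unit_cube R p x -> 1 / L <= f x)])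
  (hVcont : forall x, unit_cube R p x ->
      continuous (fun v : R => fine (K x [set y | V (x, y) <= v])))
  (hLip : forall x x', unit_cube R p x -> unit_cube R p x' -> forall v : R,
      `| fine (K x [set y | V (x, y) <= v]) - fine (K x' [set y | V (x', y) <= v]) |
        <= L * d x x')
  (hsmall : forall (n : nat) (eps : R) (x0 : p.-tuple R), 0 < eps -> eps <= h n ->
      unit_cube R p x0 -> ((eps `^ beta / L)%:E <= PX [set x | (d x0 x <= eps)%R])%E)
  (hh0 : h @ \oo --> 0)
  (hrate : (fun n : nat => n%:R * h n `^ beta / ln n%:R) @ \oo --> +oo)
  (halpha : 0 < alpha < 1)
  (x0 : p.-tuple R) (hx0 : unit_cube R p x0)
  (dO : measure_display) (Om : measurableType dO) (P : probability Om R)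
  (Zs : nat -> Om -> (p.-tuple R * Y)%type) (W : Om -> Y)
  (hZm : forall i, measurable_fun setT (Zs i)) (hWm : measurable_fun setT W)
  (hZlaw : forall i (A : set (p.-tuple R)) (B : set Y), measurable A -> measurable B ->
      P (Zs i @^-1` (A `*` B)) = (\int[PX]_(x in A) K x B)%E)
  (hWlaw : forall B : set Y, measurable B -> P (W @^-1` B) = K x0 B)
  (hindep : forall (s : seq nat) (A : nat -> set (p.-tuple R * Y)) (B : set Y),
      uniq s -> (forall i, measurable (A i)) -> measurable B ->
      fine (P (W @^-1` B `&` \big[setI/setT]_(i <- s) (Zs i @^-1` A i)))
        = fine (P (W @^-1` B)) * \prod_(i <- s) fine (P (Zs i @^-1` A i))) :
  let Xs n om := sampleX n Zs x0 om in
  let Vs n om := sampleV V n Zs x0 W om in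
  [/\ (fun n => P [set om | conf_set d (h n) (Xs n om) (Vs n om) alpha (Vs n om ord_max)])
        @ \oo --> alpha%:E,
      (fun n => P [set om | ((Vs n om ord_max)%:E
                    <= Fhat_quantile d (h n) (Xs n om) (Vs n om) alpha)%E])
        @ \oo --> alpha%:E &
      forall eps : R, 0 < eps ->
        (fun n => P [set om | sup (range (fun v : R =>
                      `| alpha_tilde d (h n) (Xs n om) (Vs n om) alpha v - alpha |)) < eps])
        @ \oo --> 1%E].
Proof.
have mcube := @measurable_unit_cube R p.
have ball n x : unit_cube R p x ->
    ((h n `^ beta / L)%:E <= PX [set x' | (d x x' <= h n)%R])%E.
  by move=> ux; exact: hsmall.
split.
- exact: (conf_set_coverage_cvg hV hdm hd0 hL hbeta halpha mcube hPXcube hVcont hLip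
    hh hh0 hrate ball hx0 hZm hWm hZlaw hWlaw hindep).
- exact: (Fhat_coverage_cvg hV hdm hd0 hL hbeta halpha mcube hPXcube hVcont hLip
    hh hh0 hrate ball hx0 hZm hWm hZlaw hWlaw hindep).
- move=> eps eps0.
  exact: (alpha_tilde_uniform_cvg hV hdm hd0 hL hbeta halpha mcube hPXcube hVcont hLip
    hh hh0 hrate ball hx0 hZm hWm hZlaw hindep eps0).
Qed.
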